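(* Let $X$ be a Banach space and let $C \in \mathcal{B}(X)$, i.e. $C$ is a nonempty, bounded, closed, convex subset of $X$. Then $C$ is weakly compact if and only if $C$ has the $(w,\mathcal{G})$-FPP for affine bi-Lipschitz maps; that is, if and only if for every $\tau \in \mathcal{T}_w$ and every $K \in \mathcal{K}_\tau(C)$, every affine bi-Lipschitz map $T\colon K \to K$ has a fixed point.
   Context: Let $(X,\|\cdot\|)$ be a Banach space. $\mathcal{T}_w$ denotes the family of all Hausdorff locally convex topologies on $X$ that are weaker (coarser) than the weak topology $\sigma(X,X^* )$. For a convex set $C\subset X$, $\mathcal{B}(C)$ denotes the family of all nonempty, bounded, (norm-)closed, convex subsets of $C$. For $\tau\in\mathcal{T}_w$, $\mathcal{K}_\tau(C)$ denotes the subfamily of $\mathcal{B}(C)$ consisting of those sets that are $\tau$-compact. A set $C\in\mathcal{B}(X)$ has the $(w,\mathcal{G})$-FPP for a class $\mathcal{M}$ of maps if whenever $\tau\in\mathcal{T}_w$ and $K\in\mathcal{K}_\tau(C)$, every map $T\colon K\to K$ belonging to $\mathcal{M}$ has a fixed point (a point $x\in K$ with $Tx=x$). A map $T\colon K\to K$ on a convex set is affine if $T(tx+(1-t)y)=tTx+(1-t)Ty$ for all $x,y\in K$, $t\in[0,1]$; it is bi-Lipschitz if there are constants $0<c\le L<\infty$ with $c\|x-y\|\le\|Tx-Ty\|\le L\|x-y\|$ for all $x,y\in K$. *)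

(* Defs.v *)
From HB Require Import structures.
From mathcomp Require Import all_boot all_order all_algebra.
From mathcomp Require Import all_classical all_reals all_analysis.

Set Implicit Arguments.
Unset Strict Implicit.
Unset Printing Implicit Defensive.

Import Order.TTheory GRing.Theory Num.Theory.
Import numFieldNormedType.Exports.

Local Open Scope classical_set_scope.
Local Open Scope ring_scope.

(* A topology on a type that already carries a canonical one has to be given as
   data: here, as its family of open sets. *)
Record topology_on (X : Type) := TopologyOn {
  opens :> set_system X ;
  opens_setT : opens setT ;
  opens_setI : setI_closed opens ;
  opens_bigcup : forall (I : Type) (f : I -> set X),
    (forall i, opens (f i)) -> opens (\bigcup_i f i) }.

(* The alias hides the canonical topology of X but keeps its linear structure. *)
Definition retopologized (X : Type) (tau : topology_on X) : Type := X.

HB.instance Definition _ (X : choiceType) (tau : topology_on X) :=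
  Choice.on (retopologized tau).
HB.instance Definition _ (X : choiceType) (tau : topology_on X) :=
  isOpenTopological.Build (retopologized tau)
    (opens_setT tau) (@opens_setI _ tau) (@opens_bigcup _ tau).
HB.instance Definition _ (R : numDomainType) (X : lmodType R)
  (tau : topology_on X) := GRing.Lmodule.on (retopologized tau).

(* These are the fields of the factory PreTopologicalLmod_isTvs: the library's
   tvsType is already locally convex. *)
Definition locally_convex_space (R : numDomainType)
    (E : preTopologicalLmodType R) : Prop :=
  [/\ continuous (fun x : E * E => x.1 + x.2),
      continuous (fun z : R^o * E => z.1 *: z.2) &
      exists2 B : set_system E,
        (forall b, b \in B -> convex_set b) & basis B].

Section BanachSpace.
Context {R : realType} {X : completeNormedModType R}.
Implicit Types (tau : topology_on X) (C K : set X) (T : X -> X).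

(* sigma(X, X^* ): the supremum of the initial topologies of the norm-continuous
   linear functionals. *)
Definition weak_space : topologicalType :=
  @sup_topology X {f : {linear X -> R^o} | continuous f}
    (fun f => Topological.class (initial_topology (sval f))).

(* "Weaker" is not strict: the weak topology itself is not excluded. *)
Definition calTw tau : Prop :=
  [/\ hausdorff_space (retopologized tau),
      locally_convex_space (retopologized tau) &
      tau `<=` (@open weak_space : set_system X)].

Definition calB C : set (set X) :=
  [set K | [/\ K !=set0, bounded_set K, closed K, convex_set K & K `<=` C]].

Definition calK tau C : set (set X) :=
  [set K | calB C K /\ @compact (retopologized tau) K].

Definition weakly_compact C : Prop := @compact weak_space C.

(* Self-maps of K are total maps on X sending K into K; whatever is assumed of
   them only concerns their values on K. *)
Definition has_wG_FPP (M : set X -> (X -> X) -> Prop) C : Prop :=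
  forall tau, calTw tau -> forall K, calK tau C K ->
  forall T, set_fun K K T -> M K T -> exists2 x, K x & T x = x.

Definition affine_on K T : Prop :=
  forall x y, K x -> K y -> forall t : R, 0 <= t <= 1 ->
  T (t *: x + (1 - t) *: y) = t *: T x + (1 - t) *: T y.

Definition bi_lipschitz_on K T : Prop :=
  exists c L : R, [/\ 0 < c, c <= L &
    forall x y, K x -> K y ->
      c * `|x - y| <= `|T x - T y| /\ `|T x - T y| <= L * `|x - y|].

Definition affine_bi_lipschitz K T : Prop :=
  affine_on K T /\ bi_lipschitz_on K T.

End BanachSpace.

(* Main.v *)
Require Import Defs.
From HB Require Import structures.
From mathcomp Require Import all_boot all_order all_algebra.
From mathcomp Require Import all_classical all_reals all_analysis.
From mathcomp Require Import ring lra.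

(* If C is weakly compact, the Cesaro means y_n of an orbit of T satisfy
   |T y_n - y_n| -> 0; by Mazur's theorem a weak cluster point of (y_n) is
   norm-close to every convex set {y | |T y - y| <= e}, hence is fixed.

   If C is not weakly compact, an ultrafilter U on C has no weak limit, and then
   for some d > 0 each y is at distance at least d from some convex set of U
   (i.e. the limit of U in X** is at positive distance from X).  Separation from affine
   subspaces of finite dimension yields x0, x0 + z_0, x0 + z_1, ... in C and
   functionals e_n with sup |e_n| finite and e_n (z_m) = 1 if n <= m, 0
   otherwise, while the functionals f with f (z_m) -> 0 separate the points of X.
   In the topology tau of these f the sequence x0 + z_n tends to x0, so the
   simplex K = {x0 + sum t_n z_n | t_n >= 0, sum t_n <= 1} is tau-compact.
   Moving a fraction eps_n of the mass of each vertex to the next one, x0 being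
   vertex 0, is an affine self-map of K without fixed point; for small eps_n it
   is the identity plus a map of Lipschitz constant 1/2, so it is bi-Lipschitz. *)

Set Implicit Arguments.
Unset Strict Implicit.
Unset Printing Implicit Defensive.

Import Order.TTheory GRing.Theory Num.Theory.
Import numFieldNormedType.Exports.

Local Open Scope classical_set_scope.
Local Open Scope ring_scope.

(** * The Hahn-Banach theorem *)

Section HahnBanach.
Context {R : realType} {V : lmodType R}.
Implicit Types (p q : V -> R) (G : set (V * R)).

Definition sublinear p :=
  (forall x y, p (x + y) <= p x + p y) /\
  (forall a x, 0 <= a -> p (a *: x) = a * p x).

Lemma sublinear0 p : sublinear p -> p 0 = 0.
Proof. by move=> [_ /(_ 0 0 (lexx 0))]; rewrite scale0r mul0r. Qed.

Lemma sublinearN p x : sublinear p -> - p (- x) <= p x.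
Proof.
move=> sp; have := sp.1 x (- x); rewrite subrr sublinear0// => h; lra.
Qed.

(** The witness is the infimum over [u] in [G] of [p (x + u.1) - u.2]. It is finite because
    [p (x + u.1) + p (- x) >= p u.1 >= u.2] bounds it below by [- p (- x)]. Both uses take for [G] a
    cone: a single ray for additivity, the cone over a convex set for separation. *)
Lemma lower_envelope p G : sublinear p -> G (0, 0) ->
  (forall u w, G u -> G w -> G (u.1 + w.1, u.2 + w.2)) ->
  (forall a u, 0 <= a -> G u -> G (a *: u.1, a * u.2)) ->
  (forall u, G u -> u.2 <= p u.1) ->
  exists q, [/\ sublinear q, forall x, q x <= p x &
    forall u x, G u -> q x <= p (x + u.1) - u.2].
Proof.
move=> sp G0 GD GZ Gp.
pose S x := [set p (x + u.1) - u.2 | u in G].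
have Slb x : has_lbound (S x).
  exists (- p (- x)) => _ [u Gu <-].
  have := sp.1 (x + u.1) (- x); rewrite addrAC subrr add0r => h.
  have := Gp _ Gu; lra.
have Si x : has_inf (S x) by split => //; exists (p (x + 0) - 0), (0, 0).
have qG u x : G u -> inf (S x) <= p (x + u.1) - u.2.
  by move=> Gu; apply: ge_inf => //; exists u.
exists (fun x => inf (S x)); split => //; last first.
  by move=> x; have := qG _ x G0; rewrite addr0 subr0.
split=> [x y|a x].
  rewrite -lerBlDr; apply: lb_le_inf; first by case: (Si x).
  move=> _ [u Gu <-]; rewrite lerBlDr -lerBlDl; apply: lb_le_inf.
    by case: (Si y).
  move=> _ [w Gw <-].
  have := qG _ (x + y) (GD _ _ Gu Gw) => /=.
  have := sp.1 (x + u.1) (y + w.1); rewrite addrACA => h1 h2; lra.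
(* One inequality is enough: the reverse one is this one for [a^-1] at [a *: x]. *)
have hle b y : 0 < b -> inf (S (b *: y)) <= b * inf (S y).
  move=> b0; rewrite -ler_pdivrMl//; apply: lb_le_inf; first by case: (Si y).
  move=> _ [u Gu <-]; rewrite ler_pdivrMl//.
  have := qG _ (b *: y) (GZ b u (ltW b0) Gu) => /=.
  by rewrite -scalerDr sp.2 ?(ltW b0)// mulrBr.
rewrite le_eqVlt => /orP[/eqP <-|a0].
  rewrite scale0r mul0r; apply/eqP; rewrite eq_le; apply/andP; split.
    by have := qG _ 0 G0; rewrite addr0 subr0 sublinear0.
  apply: lb_le_inf; first by case: (Si 0).
  by move=> _ [u Gu <-]; rewrite add0r subr_ge0 Gp.
apply/eqP; rewrite eq_le hle//=.
have ai : 0 < a^-1 by rewrite invr_gt0.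
have := hle _ (a *: x) ai.
by rewrite scalerA mulVf ?gt_eqF// scale1r ler_pdivlMl.
Qed.

(** Zorn's lemma for the reversed pointwise order. The pointwise infimum of a chain is again
    sublinear, and it is finite because every member is bounded below by [- p (- x)]. *)
Lemma minimal_sublinear p : sublinear p ->
  exists q, [/\ sublinear q, forall x, q x <= p x &
    forall q', sublinear q' -> (forall x, q' x <= q x) -> q' = q].
Proof.
move=> sp.
pose P q := sublinear q /\ forall x, q x <= p x.
pose T := {q | P q}.
pose r (s t : T) := `[< forall x, sval t x <= sval s x >].
have [||||[q [sq qp]] qmin] := @Zorn T r.
- by move=> t; apply/asboolP.
- move=> s t u /asboolP h1 /asboolP h2; apply/asboolP => x.
  exact: le_trans (h2 x) (h1 x).
- move=> [s Ps] [t Pt] /asboolP h1 /asboolP h2; apply: eq_exist => /=.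
  by apply/funext => x; apply/eqP; rewrite eq_le h1 h2.
- move=> A Atot; have [[t0 At0]|A0] := pselect (A !=set0); last first.
    exists (exist P p (conj sp (fun x => lexx (p x)))) => s As.
    by exfalso; apply: A0; exists s.
  pose S x := [set sval t x | t in A].
  have Slb x : has_lbound (S x).
    exists (- p (- x)) => _ [[t [st tp]] At <-] /=.
    by apply: le_trans (sublinearN _ st); rewrite lerN2.
  have Sn x : S x !=set0 by exists (sval t0 x), t0.
  have iS x t : A t -> inf (S x) <= sval t x.
    by move=> At; apply: ge_inf => //; exists t.
  suff PS : P (fun x => inf (S x)).
    by exists (exist P _ PS) => s As; apply/asboolP => x /=; exact: iS.
  split; last by move=> x; apply: le_trans (iS x _ At0) ((svalP t0).2 x).
  split=> [x y|a x].
    rewrite -lerBlDr; apply: lb_le_inf => // _ [t At <-].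
    rewrite lerBlDr -lerBlDl; apply: lb_le_inf => // _ [u Au <-].
    rewrite lerBlDl.
    (* Subadditivity of the infimum uses the chain: the smaller of the two members can replace
       both. *)
    have [/asboolP tu|/asboolP ut] := Atot _ _ At Au.
      apply: le_trans (iS _ _ Au) _; apply: le_trans ((svalP u).1.1 x y) _.
      by rewrite lerD2r tu.
    apply: le_trans (iS _ _ At) _; apply: le_trans ((svalP t).1.1 x y) _.
    by rewrite lerD2l ut.
  rewrite le_eqVlt => /orP[/eqP <-|a0].
    have E : S (0 *: x) = [set 0].
      apply/seteqP; split => [_ [t At <-]|_ ->] /=.
        by rewrite scale0r (sublinear0 (svalP t).1).
      by exists t0 => //; rewrite scale0r (sublinear0 (svalP t0).1).
    by rewrite E inf1 mul0r.
  have E (t : T) : sval t (a *: x) = a * sval t x by rewrite (svalP t).1.2 ?ltW.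
  apply/eqP; rewrite eq_le; apply/andP; split.
    rewrite -ler_pdivrMl//; apply: lb_le_inf => // _ [t At <-].
    by rewrite ler_pdivrMl// -E; exact: iS.
  apply: lb_le_inf => // _ [t At <-].
  by rewrite E ler_pM2l//; exact: iS.
- exists q; split => // q' sq' q'q.
  have Pq' : P q' by split => // x; exact: le_trans (q'q x) (qp x).
  have := qmin (exist P q' Pq').
  by move=> /(_ (introT (asboolP _) q'q)) [].
Qed.

(** A minimal sublinear functional is linear: its lower envelope along the ray through [(y, q y)] is
    below [q], hence equal to [q], so that [q x <= q (x + y) - q y]. *)
Lemma sublinear_dominates p : sublinear p ->
  exists f : {linear V -> R^o}, forall x, f x <= p x.
Proof.
move=> /minimal_sublinear[q [sq qp qmin]].
have qD x y : q (x + y) = q x + q y.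
  apply/eqP; rewrite eq_le sq.1/=.
  have [||||q' [sq' q'q q'G]] :=
      @lower_envelope q [set u | exists2 t, 0 <= t & u = (t *: y, t * q y)] sq.
  - by exists 0; rewrite ?scale0r ?mul0r.
  - move=> _ _ [t t0 ->] [s s0 ->] /=; exists (t + s); first exact: addr_ge0.
    by rewrite scalerDl mulrDl.
  - move=> a _ a0 [t t0 ->]; exists (a * t); first exact: mulr_ge0.
    by rewrite scalerA mulrA.
  - by move=> _ [t t0 ->] /=; rewrite sq.2.
  have := q'G (y, q y) x; rewrite (qmin _ sq' q'q) /= lerBrDr; apply.
  by exists 1; rewrite ?scale1r ?mul1r.
have qN x : q (- x) = - q x.
  by apply/eqP; rewrite -addr_eq0 -qD addNr (sublinear0 sq).
have qlin : linear (q : V -> R^o).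
  move=> a x y; rewrite qD; congr (_ + _).
  have [a0|/ltW a0] := leP 0 a; first by rewrite sq.2.
  rewrite -[a]opprK scaleNr qN sq.2 ?oppr_ge0//.
  by rewrite -mulNr.
pose L := GRing.isLinear.Build R V R^o _ q qlin.
by exists (HB.pack (q : V -> R^o) L : {linear V -> R^o}).
Qed.

(** Take the lower envelope of [p] over the cone generated by [D] at height [r]. For [x] in [D] its
    value at [- x] is at most [p 0 - r = - r], so a linear [f] below it satisfies [f x >= r]. *)
Lemma mazur_orlicz p (D : set V) (r : R) : sublinear p ->
  D !=set0 ->
  (forall x y (t : R), D x -> D y -> 0 <= t -> t <= 1 ->
    D (t *: x + (1 - t) *: y)) ->
  (forall x, D x -> r <= p x) ->
  exists f : {linear V -> R^o},
    (forall x, f x <= p x) /\ (forall x, D x -> r <= f x).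
Proof.
move=> sp [d0 Dd0] Dc Dr.
have [||||q [sq qp qG]] := @lower_envelope p
   [set u | exists t d, [/\ 0 <= t, D d & u = (t *: d, t * r)]] sp.
- by exists 0, d0; rewrite scale0r mul0r.
- move=> _ _ [t [d [t0 Dd ->]]] [s [e [s0 De ->]]] /=.
  (* With zero total weight the convex combination below is undefined; any point of [D] represents
     the apex of the cone. *)
  have [ts|ts] := eqVneq (t + s) 0.
    have [-> ->] : t = 0 /\ s = 0 by split; lra.
    by exists 0, d0; rewrite !scale0r !mul0r !addr0.
  have ts0 : 0 < t + s by rewrite lt_neqAle eq_sym ts addr_ge0.
  exists (t + s), ((t / (t + s)) *: d + (1 - t / (t + s)) *: e); split.
  + exact: ltW.
  + apply: Dc => //; first by rewrite divr_ge0// ltW.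
    by rewrite ler_pdivrMr// mul1r lerDl.
  + rewrite scalerDr !scalerA -mulrDl; congr (_ *: _ + _ *: _, _).
      by field.
    by field.
- move=> a _ a0 [t [d [t0 Dd ->]]]; exists (a * t), d; split => //.
    exact: mulr_ge0.
  by rewrite scalerA mulrA.
- by move=> _ [t [d [t0 Dd ->]]] /=; rewrite sp.2// ler_wpM2l// Dr.
have [f fq] := sublinear_dominates sq.
exists f; split => [x|x Dx]; first exact: le_trans (fq x) (qp x).
have := qG (x, r) (- x); rewrite /= addNr (sublinear0 sp).
move=> /(_ _); have h : exists (t : R) d, [/\ 0 <= t, D d & (x, r) = (t *: d, t * r)].
  by exists 1, x; rewrite scale1r mul1r.
move=> /(_ h) h2; have := fq (- x); rewrite linearN /= => h3.
by have := le_trans h3 h2; rewrite sub0r lerN2.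
Qed.

End HahnBanach.

(** * Separation by functionals of norm at most 1 *)

Section NormedFunctionals.
Context {R : realType} {X : normedModType R}.

Lemma sublinear_norm : sublinear (fun x : X => `|x|).
Proof.
split=> [x y|a x a0]; first exact: ler_normD.
by rewrite normrZ ger0_norm.
Qed.

Lemma dominated_by_norm (f : {linear X -> R^o}) :
  (forall x, f x <= `|x|) -> forall x, `|f x : R| <= `|x|.
Proof.
move=> fp x; rewrite ler_norml fp andbT lerNl.
by have := fp (- x); rewrite linearN normrN.
Qed.

Lemma mazur_separation (D : set X) (r : R) :
  D !=set0 ->
  (forall x y (t : R), D x -> D y -> 0 <= t -> t <= 1 ->
    D (t *: x + (1 - t) *: y)) ->
  (forall x, D x -> r <= `|x|) ->
  exists f : {linear X -> R^o},
    (forall x, `|f x : R| <= `|x|) /\ (forall x, D x -> r <= f x).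
Proof.
move=> D0 Dc Dr; have [f [f1 f2]] := mazur_orlicz sublinear_norm D0 Dc Dr.
by exists f; split => //; exact: dominated_by_norm.
Qed.

Lemma bounded_set_norm (A : set X) : bounded_set A ->
  exists2 B : R, 0 < B & forall x, A x -> `|x| <= B.
Proof.
move=> [m [_ Am]]; exists (`|m| + 1); first by rewrite ltr_wpDl.
move=> x Ax; apply: (Am (`|m| + 1)) => //.
by rewrite (le_lt_trans (ler_norm m))// ltrDl.
Qed.

Lemma linear_bounded_cont (f : {linear X -> R^o}) (M : R) :
  (forall x, `|f x : R| <= M * `|x|) -> continuous (f : X -> R^o).
Proof.
move=> fM; apply/linear_bounded_continuous/linear_boundedP.
exists M; split; first exact: num_real.
move=> r Mr x; apply: le_trans (fM x) _.
by rewrite ler_wpM2r// ltW.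
Qed.

End NormedFunctionals.

Lemma convex_combB {R : pzRingType} {V : lmodType R} (a : R) (x y z : V) :
  a *: x + (1 - a) *: y - z = a *: (x - z) + (1 - a) *: (y - z).
Proof.
rewrite !scalerBr addrACA -opprD; congr (_ - _).
by rewrite -scalerDl addrC subrK scale1r.
Qed.

Lemma convex_setP {R : realType} {M : lmodType R} (A : set M) :
  convex_set A <-> (forall x y (t : R), A x -> A y -> 0 <= t -> t <= 1 ->
    A (t *: x + (1 - t) *: y)).
Proof.
split=> [Ac x y t Ax Ay t0 t1|Ac x y t /set_mem Ax /set_mem Ay].
  exact: set_mem (Ac x y (Itv01 t0 t1) (mem_set Ax) (mem_set Ay)).
by apply/mem_set; exact: (Ac x y t%:num Ax Ay (ge0 t) (le1 t)).
Qed.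

(** * The weak topology and weakly compact convex sets *)

Section WeakTopology.
Context {R : realType} {X : completeNormedModType R}.
Notation weakX := (@weak_space R X).
Implicit Types (f : {linear X -> R^o}) (p x y : X).

Lemma nbhs_weak f p (e : R) : continuous f -> 0 < e ->
  nbhs (p : weakX) [set y | `|f p - f y : R| < e].
Proof.
move=> fc e0.
have /cvg_sup : nbhs (p : weakX) --> (p : weakX) by [].
move=> /(_ (exist _ f fc)); apply.
have /(_ p _ (@nbhsx_ballx _ R^o (f p) e e0)) := @initial_continuous _ _ (f : X -> R^o).
by [].
Qed.

Lemma weak_cvgP (F : set_system X) p : Filter F ->
  (forall f, continuous f ->
    forall e : R, 0 < e -> F [set y | `|f p - f y : R| < e]) ->
  F --> (p : weakX).
Proof.
move=> FF Fp; apply/cvg_sup => -[f fc] A.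
rewrite nbhsE => -[_ [[B oB <-] Bfp] BA].
have : nbhs (f p : R^o) B by exact: open_nbhs_nbhs.
move=> /nbhs_ballP[e /= e0 eB].
apply: filterS (Fp f fc e e0) => y ye.
by apply: BA; apply: eB.
Qed.

(** Mazur's theorem for filters: if [A] had distance at least [d] from [p], a functional of norm at
    most 1 would be at least [d] on [A - p], and a weak neighbourhood of [p] would miss [A]. *)
Lemma weak_cluster_convex (F : set_system X) (A : set X) p (d : R) :
  ProperFilter F -> F A -> convex_set A -> cluster (F : set_system weakX) p ->
  0 < d -> exists2 y, A y & `|p - y| < d.
Proof.
move=> FF FA /convex_setP Ac pF d0; apply: contrapT => nA.
have Ad y : A y -> d <= `|y - p|.
  by move=> Ay; rewrite leNgt distrC; apply/negP => h; apply: nA; exists y.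
have [|||f [fn fd]] := @mazur_separation _ _ [set y - p | y in A] d.
- by have [y Ay] := filter_ex FA; exists (y - p), y.
- move=> _ _ t [x Ax <-] [y Ay <-] t0 t1.
  exists (t *: x + (1 - t) *: y); first exact: Ac.
  exact: convex_combB.
- by move=> _ [y Ay <-]; exact: Ad.
have fc : continuous f.
  by apply: (@linear_bounded_cont _ _ f 1) => x; rewrite mul1r.
have [y [Ay /=]] := pF _ _ FA (nbhs_weak p fc d0).
apply/negP; rewrite -leNgt distrC -linearB.
apply: le_trans (ler_norm _); apply: fd; by exists y.
Qed.

(** * Fixed points of affine Lipschitz maps *)

Section FixedPoint.
Variables (K : set X) (T : X -> X).
Hypotheses (K0 : K !=set0) (Kb : bounded_set K) (Kc : convex_set K).
Hypotheses (KT : set_fun K K T) (Taff : affine_on K T).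

Lemma approximate_fixed_points (e : R) : 0 < e ->
  exists2 y, K y & `|T y - y| <= e.
Proof.
move=> e0; have [x Kx] := K0.
have KT' y : K y -> K (T y) by move=> ?; exact: KT.
have Kit n : K (iter n T x) by elim: n => [//|n IH] /=; exact: KT'.
(* [y n] is the mean of the first [n.+1] points of the orbit of [x], built by two-point convex
   combinations so that convexity of [K] and affinity of [T] apply directly. Telescoping gives
   [yE]. *)
pose c n : R := n.+1%:R / n.+2%:R.
pose y := fix y n := if n is m.+1
  then c m *: y m + (1 - c m) *: iter m.+1 T x else x.
have c01 n : 0 <= c n <= 1.
  by rewrite divr_ge0//= ler_pdivrMr// mul1r ler_nat.
have Ky n : K (y n).
  elim: n => [//|n IH] /=; move/convex_setP: Kc; have /andP[? ?] := c01 n.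
  by apply=> //; exact: (Kit n.+1).
have yE n : n.+1%:R *: (T (y n) - y n) = iter n.+1 T x - x.
  elim: n => [|n IH]; first by rewrite scale1r.
  rewrite [y n.+1]/= Taff ?c01//; last exact: (Kit n.+1).
  have n0 : (n.+2%:R : R) != 0 by [].
  rewrite opprD addrACA -!scalerBr scalerDr !scalerA.
  have -> : n.+2%:R * c n = n.+1%:R by rewrite mulrC divfK.
  have -> : n.+2%:R * (1 - c n) = 1 :> R.
    by rewrite mulrBr mulr1 [_ * c n]mulrC divfK// -natr1 addrAC subrr add0r.
  by rewrite IH scale1r [LHS]addrC addrA subrK.
have [M M0 KM] := bounded_set_norm Kb.
have [n /ltW nM] : exists n, 2 * M / e < n%:R.
  exists (Num.bound (2 * M / e)).
  by rewrite archi_boundP// divr_ge0 ?(ltW e0)// mulr_ge0// ltW.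
exists (y n) => //.
have n0 : (0 : R) < n.+1%:R by [].
rewrite -(ler_pM2l n0) -{1}(ger0_norm (ltW n0)) -normrZ yE.
apply: (le_trans (ler_normB _ _)).
have -> : n.+1%:R * e = e * n%:R + e by rewrite -natr1; ring.
move: nM; rewrite ler_pdivrMr// mulrC => nM.
have := KM _ (Kit n.+1); have := KM _ Kx => /= h1 h2.
move: nM h1 h2 e0; set a := `|x|; set b := `|T _|; lra.
Qed.

Lemma weakly_compact_fixed_point (C : set X) (L : R) :
  weakly_compact C -> K `<=` C -> closed K ->
  (forall x y, K x -> K y -> `|T x - T y| <= L * `|x - y|) ->
  exists2 x, K x & T x = x.
Proof.
move=> Cw KC Kcl TL.
pose y n := sval (cid2 (approximate_fixed_points (@divr_gt0 R 1 n.+1%:R ltr01 (ltr0Sn _ _)))).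
have Ky n : K (y n) by rewrite /y; case: cid2.
have Ty n : `|T (y n) - y n| <= 1 / n.+1%:R by rewrite /y; case: cid2.
have yC : (y @ \oo) C.
  suff : \forall n \near \oo, C (y n) by [].
  by apply: nearW => n; exact: KC.
have [p [_ py]] := Cw (y @ \oo) _ yC.
(* These sets are convex because [T] is affine, and the sequence [y] is eventually in each of
   them. *)
pose A (e : R) := [set z | K z /\ `|T z - z| <= e].
have Ae e : 0 < e -> (y @ \oo) (A e).
  move=> e0; suff : \forall n \near \oo, A e (y n) by [].
  near=> n; split; first exact: Ky.
  apply: le_trans (Ty n) _; rewrite div1r invf_ple ?posrE//.
  apply: (@le_trans _ _ n%:R); last by rewrite ler_nat.
  near: n; exact: nbhs_infty_ger.
have Acv e : convex_set (A e).
  apply/convex_setP => u v t [Ku Tu] [Kv Tv] t0 t1; split.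
    by move/convex_setP: Kc; apply.
  rewrite Taff ?t0// opprD addrACA -!scalerBr.
  apply: (le_trans (ler_normD _ _)); rewrite !normrZ !ger0_norm ?subr_ge0//.
  have -> : e = t * e + (1 - t) * e by ring.
  by rewrite lerD// ler_wpM2l// subr_ge0.
have close e d : 0 < e -> 0 < d -> exists2 z, A e z & `|p - z| < d.
  by move=> e0 d0; apply: weak_cluster_convex (Ae e e0) (Acv e) py d0.
have Kp : K p.
  rewrite closure_id in Kcl.
  rewrite Kcl => B /nbhs_ballP[d /= d0 dB].
  have [z [Kz _] pz] := close 1 d ltr01 d0.
  by exists z; split => //; apply: dB; rewrite -ball_normE.
exists p => //; apply/eqP; rewrite -subr_eq0 -normr_le0.
apply/ler_addgt0Pr => e e0; rewrite add0r.
(* With [z] in [A (e / 2)] and within [d] of [p], the errors [T p - T z] and [p - z] add up to at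
   most [(|L| + 1) * d = e / 2]. *)
pose d := e / (2 * (`|L| + 1)).
have L0 : 0 < `|L| + 1 by rewrite ltr_wpDl.
have d0 : 0 < d by rewrite divr_gt0// mulr_gt0.
have [z [Kz Tz] pz] := close (e / 2) d (divr_gt0 e0 (ltr0Sn _ 1)) d0.
have -> : T p - p = (T p - T z) + (T z - z) - (p - z).
  by rewrite opprB !addrA !subrK.
apply: (le_trans (ler_normB _ _)).
have h1 := ler_normD (T p - T z) (T z - z).
have h2 := TL _ _ Kp Kz.
have h3 : L * `|p - z| <= `|L| * `|p - z| by rewrite ler_wpM2r// ler_norm.
have h4 : (`|L| + 1) * `|p - z| <= e / 2.
  have -> : e / 2 = (`|L| + 1) * d by rewrite /d; field; rewrite gt_eqF.
  by rewrite ler_pM2l// ltW.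
lra.
Unshelve. all: by end_near.
Qed.

End FixedPoint.
End WeakTopology.

(** * Locally convex topologies from seminorms *)

Section SeminormTopology.
Context {R : realType} {X : lmodType R}.
Implicit Types (Q : set (X -> R)) (q : X -> R).

Definition seminorm q :=
  (forall x y, q (x + y) <= q x + q y) /\
  (forall (a : R) x, q (a *: x) = `|a| * q x).

Lemma seminorm0 q : seminorm q -> q 0 = 0.
Proof. by move=> [_ /(_ 0 0)]; rewrite scale0r normr0 mul0r. Qed.

Lemma seminormC q x y : seminorm q -> q (x - y) = q (y - x).
Proof.
by move=> [_ /(_ (-1) (x - y))]; rewrite scaleN1r normrN1 mul1r opprB => ->.
Qed.

Lemma seminorm_ge0 q x : seminorm q -> 0 <= q x.
Proof.
move=> sq; have := sq.1 x (- x); have := seminormC 0 x sq.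
by rewrite subrr seminorm0// sub0r subr0 => ->; lra.
Qed.

Lemma seminormB q x y z : seminorm q -> q (x - z) <= q (x - y) + q (y - z).
Proof. by move=> sq; have := sq.1 (x - y) (y - z); rewrite addrA subrK. Qed.

(** Closure under sums makes the balls of single members of [Q] a neighbourhood base, with no finite
    intersections to handle. *)
Definition directed_seminorms Q :=
  [/\ Q (fun=> 0), forall q, Q q -> seminorm q &
   forall q q', Q q -> Q q' -> Q (fun x => q x + q' x)].

Definition seminorm_open Q : set_system X :=
  [set A | forall x, A x -> exists q (e : R),
    [/\ Q q, 0 < e & forall y, q (y - x) < e -> A y]].

Section Directed.
Variables (Q : set (X -> R)) (hQ : directed_seminorms Q).
Let Q0 : Q (fun=> 0). Proof. by case: hQ. Qed.
Let Qs q : Q q -> seminorm q. Proof. by case: hQ => _ + _; exact. Qed.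
Let QD q q' : Q q -> Q q' -> Q (fun x => q x + q' x).
Proof. by case: hQ => _ _; exact. Qed.

Lemma seminorm_openT : seminorm_open Q setT.
Proof. by move=> x _; exists (fun=> 0), 1; split. Qed.

Lemma seminorm_openI : setI_closed (seminorm_open Q).
Proof.
move=> A B oA oB x [Ax Bx].
have [q [e [Qq e0 qA]]] := oA x Ax; have [q' [e' [Qq' e'0 qB]]] := oB x Bx.
exists (fun x => q x + q' x), (Num.min e e').
split; [exact: QD|by rewrite lt_min e0|move=> y].
have h := seminorm_ge0 (y - x) (Qs Qq); have h' := seminorm_ge0 (y - x) (Qs Qq').
rewrite lt_min => /andP[h1 h2]; split; [apply: qA|apply: qB].
  by apply: le_lt_trans h1; rewrite lerDl.
by apply: le_lt_trans h2; rewrite lerDr.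
Qed.

Lemma seminorm_open_bigcup (I : Type) (f : I -> set X) :
  (forall i, seminorm_open Q (f i)) -> seminorm_open Q (\bigcup_i f i).
Proof.
move=> fo x [i _ fx]; have [q [e [Qq e0 qf]]] := fo i x fx.
by exists q, e; split => // y /qf fy; exists i.
Qed.

Definition seminorm_topology : topology_on X :=
  TopologyOn seminorm_openT seminorm_openI seminorm_open_bigcup.

Local Notation E := (retopologized seminorm_topology).

Lemma seminorm_ball_open q x (e : R) : Q q ->
  @open E [set y | q (y - x) < e].
Proof.
move=> Qq; suff : seminorm_open Q [set y | q (y - x) < e] by [].
move=> y /= yx; exists q, (e - q (y - x)); split => //.
  by rewrite subr_gt0.
move=> z zy /=; apply: le_lt_trans (seminormB z y x (Qs Qq)) _.
by rewrite -ltrBrDr.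
Qed.

Lemma seminorm_nbhsP (x : X) (A : set X) : nbhs (x : E) A <->
  exists q (e : R), [/\ Q q, 0 < e & forall y, q (y - x) < e -> A y].
Proof.
split.
  rewrite nbhsE => -[B [oB Bx] BA]; have [q [e [Qq e0 qB]]] := oB x Bx.
  by exists q, e; split => // y /qB; exact: BA.
move=> [q [e [Qq e0 qA]]]; rewrite nbhsE.
exists [set y | q (y - x) < e] => //; split; first exact: seminorm_ball_open.
by rewrite /= subrr seminorm0//; exact: Qs.
Qed.

Lemma seminorm_nbhs q x (e : R) : Q q -> 0 < e ->
  nbhs (x : E) [set y | q (y - x) < e].
Proof. by move=> Qq e0; apply/seminorm_nbhsP; exists q, e. Qed.

Lemma seminorm_hausdorff : (forall x, x != 0 -> exists2 q, Q q & q x != 0) ->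
  hausdorff_space E.
Proof.
move=> Qsep x y xy; apply: contrapT => /eqP; rewrite -subr_eq0.
move=> /Qsep[q Qq qxy].
have q0 : 0 < q (x - y) / 2.
  by rewrite divr_gt0// lt_neqAle eq_sym qxy seminorm_ge0//; exact: Qs.
have [z [/= zx zy]] := xy _ _ (seminorm_nbhs x Qq q0) (seminorm_nbhs y Qq q0).
have := seminormB x z y (Qs Qq); rewrite (seminormC x z (Qs Qq)); lra.
Qed.

Lemma seminorm_locally_convex : locally_convex_space E.
Proof.
split.
- move=> [x y] A /seminorm_nbhsP[q [e [Qq e0 qA]]].
  have e20 : 0 < e / 2 by rewrite divr_gt0.
  exists ([set z | q (z - x) < e / 2], [set z | q (z - y) < e / 2]).
    by split; exact: seminorm_nbhs.
  move=> [u v] [/= ux vy]; apply: qA; rewrite /= opprD addrACA.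
  apply: le_lt_trans ((Qs Qq).1 _ _) _.
  by rewrite [e]splitr ltrD.
- move=> [a x] A /seminorm_nbhsP[q [e [Qq e0 qA]]].
  have qx0 := seminorm_ge0 x (Qs Qq).
  (* The bound is [|b| * q (y - x) + |b - a| * q x], each term getting [e / 2]. The 1 in the minimum
     gives [|b| <= |a| + 1]; the added 1 in each denominator keeps it positive. *)
  pose d := Num.min 1 (e / (2 * (q x + 1))).
  have d0 : 0 < d.
    by rewrite lt_min ltr01/= divr_gt0// mulr_gt0// ltr_wpDl.
  pose c := e / (2 * (`|a| + 1)).
  have a1 : 0 < `|a| + 1 by rewrite ltr_wpDl.
  have c0 : 0 < c by rewrite divr_gt0// mulr_gt0.
  exists ([set b : R^o | `|a - b| < d], [set z | q (z - x) < c]).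
    split; last exact: seminorm_nbhs.
    exact: (@nbhsx_ballx _ R^o a d d0).
  move=> [b y] [/= ab yx]; apply: qA => /=.
  have -> : b *: y - a *: x = b *: (y - x) + (b - a) *: x.
    by rewrite scalerBr scalerBl addrA subrK.
  apply: le_lt_trans ((Qs Qq).1 _ _) _; rewrite !(Qs Qq).2.
  move: ab; rewrite lt_min => /andP[ab1 ab2].
  have b1 : `|b| <= `|a| + 1.
    have := ler_normB a (a - b); rewrite opprB addrC subrK; lra.
  have h1 : `|b| * q (y - x) < e / 2.
    apply: (@le_lt_trans _ _ ((`|a| + 1) * q (y - x))).
      by rewrite ler_wpM2r// seminorm_ge0//; exact: Qs.
    have -> : e / 2 = (`|a| + 1) * c by rewrite /c; field; rewrite gt_eqF.
    by rewrite ltr_pM2l.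
  have h2 : `|b - a| * q x <= e / 2.
    rewrite distrC; apply: (@le_trans _ _ (`|a - b| * (q x + 1))).
      by rewrite ler_wpM2l// lerDl.
    have qx1 : 0 < q x + 1 by rewrite ltr_wpDl.
    have -> : e / 2 = e / (2 * (q x + 1)) * (q x + 1).
      by field; rewrite gt_eqF.
    by rewrite ler_pM2r// ltW.
  lra.
- exists [set A | exists q x (e : R), Q q /\ A = [set y | q (y - x) < e]].
    move=> _ /set_mem[q [x [e [Qq ->]]]]; apply/convex_setP => u v t /= ux vx t0 t1.
    rewrite convex_combB; apply: le_lt_trans ((Qs Qq).1 _ _) _; rewrite !(Qs Qq).2.
    rewrite !ger0_norm ?subr_ge0//.
    have := ler_wpM2l t0 (ltW ux).
    have t1' : 0 <= 1 - t by rewrite subr_ge0.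
    have := ler_wpM2l t1' (ltW vx).
    have [->|tn0] := eqVneq t 0; first by rewrite !mul0r !subr0 !mul1r; lra.
    have tp : 0 < t by rewrite lt_neqAle eq_sym tn0.
    have : t * q (u - x) < t * e by rewrite ltr_pM2l.
    lra.
  split; first by move=> _ [q [x [e [Qq ->]]]]; exact: seminorm_ball_open.
  move=> x A /seminorm_nbhsP[q [e [Qq e0 qA]]].
  exists [set y | q (y - x) < e] => //; split; first by exists q, x, e.
  by rewrite /= subrr seminorm0//; exact: Qs.
Qed.

End Directed.
End SeminormTopology.

(** * The topology generated by a set of functionals *)

Section AbsSums.
Context {R : realType} {X : completeNormedModType R}.
Notation weakX := (@weak_space R X).
Variable N : set {linear X -> R^o}.

(** Finite sums of [|f|] with [f] in [N]: a directed family of seminorms for the initial topology of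
    [N]. *)
Inductive abs_sum : (X -> R) -> Prop :=
| abs_sum0 : abs_sum (fun=> 0)
| abs_sumS (f : {linear X -> R^o}) q :
    N f -> abs_sum q -> abs_sum (fun x => `|f x : R| + q x).

Lemma abs_sum_directed : directed_seminorms abs_sum.
Proof.
split; first exact: abs_sum0.
- move=> q; elim=> [|f r Nf sr [r1 r2]].
    by split=> *; rewrite ?addr0 ?mulr0.
  split=> [x y|a x]; last first.
    rewrite linearZ /= r2 mulrDr; congr (_ + _).
    by rewrite [LHS](normrM a (f x)).
  rewrite linearD; have := r1 x y.
  have := ler_normD (f x : R) (f y); lra.
- move=> q q' sq sq'; elim: sq => [|f r Nf sr IH].
    by under eq_fun do rewrite add0r.
  under eq_fun do rewrite -addrA.
  exact: abs_sumS.
Qed.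

Lemma abs_sum_weak_nbhs q (x : X) (e : R) : (forall f, N f -> continuous f) ->
  abs_sum q -> 0 < e -> nbhs (x : weakX) [set y | q (y - x) < e].
Proof.
move=> Nc sq; elim: sq e => [|f r Nf sr IH] e e0.
  by apply: filterS filterT => y _.
have e20 : 0 < e / 2 by rewrite divr_gt0.
apply: filterS (filterI (nbhs_weak x (Nc f Nf) e20) (IH _ e20)) => y [/= h1 h2].
by rewrite linearB distrC [e]splitr ltrD.
Qed.

(** Separation of points by [N] gives the Hausdorff property; continuity of the functionals makes
    every ball of an [abs_sum] a weak neighbourhood of its centre. *)
Lemma abs_sum_calTw : (forall f, N f -> continuous f) ->
  (forall x, x != 0 -> exists2 f, N f & f x != 0) ->
  calTw (seminorm_topology abs_sum_directed).
Proof.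
move=> Nc Nsep; split.
- apply: seminorm_hausdorff => x /Nsep[f Nf fx].
  exists (fun x => `|f x : R| + 0); first exact/abs_sumS/abs_sum0.
  by rewrite addr0 normr_eq0.
- exact: seminorm_locally_convex.
- move=> A oA; rewrite openE => x Ax.
  have [q [e [sq e0 qA]]] := oA x Ax.
  by apply: filterS (abs_sum_weak_nbhs x Nc sq e0).
Qed.

End AbsSums.

(** * Infinite simplices and their slow shift *)

Section Preliminaries.
Context {R : realType}.

Lemma ultra_bounded_cvg (T : Type) (F : set_system T) (g : T -> R) (B : R) :
  UltraFilter F -> F [set x | `|g x| <= B] -> exists l : R, g @ F --> l.
Proof.
move=> FU FB; have FF := @ultra_proper _ _ FU.
have gB : (g @ F) `[- B, B]%classic.
  suff : F [set x | `[- B, B]%classic (g x)] by [].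
  by apply: filterS FB => x /=; rewrite in_itv/= -ler_norml.
have [l [_ lF]] := segment_compact _ gB; exists l.
apply/cvgrPdist_lt => e e0.
have [//|nF] := in_ultra_setVsetC [set x | `|l - g x| < e] FU.
have nF' : (g @ F) [set y | ~ (`|l - y| < e)] by exact: nF.
by have [y [/= h1 h2]] := lF _ _ nF' (@nbhsx_ballx _ R^o l e e0).
Qed.

Lemma eventually_eq_cvg (V : normedModType R) (u v : nat -> V) (l : V) (N : nat) :
  (forall n, (N <= n)%N -> u n = v n) -> u @ \oo --> l -> v @ \oo --> l.
Proof.
move=> uv /cvgrPdist_lt ul; apply/cvgrPdist_lt => e e0; near=> n.
rewrite -uv; last by near: n; exact: nbhs_infty_ge.
by near: n; exact: ul.
Unshelve. all: by end_near.
Qed.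

Lemma cvg_comb (V : normedModType R) (u v : nat -> V) (a b : R) (l m : V) :
  u @ \oo --> l -> v @ \oo --> m ->
  (fun n => a *: u n + b *: v n) @ \oo --> a *: l + b *: m.
Proof.
by move=> ul vm; apply: cvgD; apply: cvgZ => //; exact: cvg_cst.
Qed.

Lemma sum_half_powers n :
  \sum_(0 <= i < n) (2%:R ^- i.+1) = 1 - 2%:R ^- n :> R.
Proof.
elim: n => [|n IH]; first by rewrite big_geq// expr0 invr1 subrr.
rewrite big_nat_recr//= IH exprS; field.
by rewrite expf_neq0.
Qed.

Lemma near_half_power_lt k (c : R) : 0 < c ->
  \forall n \near \oo, 2%:R ^- (k + n) < c.
Proof.
move=> c0; have := @cvg_geometric R (2^-1 ^+ k) 2^-1 _.
rewrite ger0_norm ?invr_ge0// invf_lt1// ltr1n => /(_ isT).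
move=> /cvgr0_norm_lt /(_ _ c0); apply: filterS => n /=.
rewrite ger0_norm ?mulr_ge0 ?exprn_ge0 ?invr_ge0//.
by rewrite -exprD exprVn.
Qed.

Lemma absolutely_summable_cvg (V : completeNormedModType R) (u : V ^nat)
    (v : R ^nat) (B : R) :
  (forall n, `|u n| <= v n) -> (forall n, \sum_(0 <= i < n) v i <= B) ->
  exists2 l, series u @ \oo --> l & `|l| <= B.
Proof.
move=> uv vB.
have nB n : \sum_(0 <= i < n) `|u i| <= B.
  by apply: le_trans (vB n); apply: ler_sum => i _; exact: uv.
have cu : cvgn (series u).
  apply: normed_cvg; apply: nondecreasing_is_cvgn.
    apply/nondecreasing_seqP => n; rewrite /= /series/= big_nat_recr//=.
    by rewrite lerDl.
  by exists B => _ [n _ <-]; exact: nB.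
exists (limn (series u)) => //.
have h : (fun n => `|series u n|) @ \oo --> `|limn (series u)|.
  exact: (@cvg_norm _ V).
apply: (@closed_cvg _ R^o _ _ _ [set x | x <= B] _ _ _ h).
  exact: closed_le.
by apply: nearW => n /=; apply: le_trans (ler_norm_sum _ _ _) (nB n).
Qed.

End Preliminaries.

Definition null_functionals {R : realType} {X : normedModType R}
    (z : nat -> X) : set {linear X -> R^o} :=
  [set f | continuous f /\ (f \o z : nat -> R^o) @ \oo --> (0 : R^o)].

Section Simplex.
Context {R : realType} {X : completeNormedModType R}.
Variables (C : set X) (x0 : X) (z : nat -> X) (e : nat -> {linear X -> R^o}).
Variables (M : R).
Hypotheses (Cx0 : C x0) (Cz : forall n, C (x0 + z n)).
Hypotheses (Cc : convex_set C) (Cb : bounded_set C) (Ccl : closed C).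
Hypothesis eM : forall n x, `|e n x : R| <= M * `|x|.
Hypothesis ez : forall n m, e n (z m) = (n <= m)%:R.

Local Notation N := (null_functionals z).
Hypothesis Nsep : forall x, x != 0 -> exists2 f, N f & f x != 0.

(** The sum may be less than 1: the missing mass sits at the vertex [x0]. *)
Definition weights (t : nat -> R) :=
  (forall n, 0 <= t n) /\ (forall n, \sum_(0 <= i < n) t i <= 1).

Definition represents t x :=
  weights t /\ series (fun n => t n *: z n) @ \oo --> x - x0.

Definition simplex := [set x | exists t, represents t x].

Lemma z_bounded : exists2 B, 0 < B & forall n, `|z n| <= B.
Proof.
have [B B0 CB] := bounded_set_norm Cb.
exists (B + B); first by rewrite addr_gt0.
move=> n; have -> : z n = (x0 + z n) - x0 by rewrite addrC addrA addNr add0r.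
by apply: (le_trans (ler_normB _ _)); rewrite lerD// CB.
Qed.

Lemma represents_ex t : weights t -> exists x, represents t x.
Proof.
move=> wt; have [B B0 zB] := z_bounded.
have [|n|l tl _] := @absolutely_summable_cvg R X (fun n => t n *: z n)
  (fun n => t n * B) B.
- by move=> n; rewrite normrZ ger0_norm ?wt.1// ler_wpM2l ?wt.1.
- by rewrite -mulr_suml ler_piMl ?wt.2 ?(ltW B0).
- by exists (x0 + l); split => //; rewrite addrC addKr.
Qed.

Lemma represents_eval t x (f : {linear X -> R^o}) : represents t x ->
  continuous f -> (fun n => \sum_(0 <= i < n) t i * f (z i)) @ \oo --> f (x - x0).
Proof.
move=> [_ tx] fc.
have cvh : (f \o series (fun n => t n *: z n) : nat -> R^o) @ \oo --> (f (x - x0) : R^o).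
  by apply: (@continuous_cvg _ _ _ _ _ _ (f : X -> R^o)); [exact: fc|exact: tx].
apply: (eventually_eq_cvg (N:=0%N) _ cvh) => n _ /=.
rewrite /series/= linear_sum; apply: eq_bigr => i _.
by rewrite linearZ.
Qed.

(** The remaining weights have total at most 1. The bound does not depend on the point, so on the
    simplex a functional that is null along [z] is uniformly approximated by finitely many
    coordinates. *)
Lemma represents_tail t x (f : {linear X -> R^o}) n (d : R) :
  represents t x -> continuous f -> 
  (forall i, (n <= i)%N -> `|f (z i) : R| <= d) ->
  `|f (x - x0) - \sum_(0 <= i < n) t i * f (z i) : R| <= d.
Proof.
move=> tx fc fd; have wt := tx.1.
have d0 : 0 <= d by apply: le_trans (normr_ge0 _) (fd n (leqnn n)).
have := represents_eval tx fc.
move=> /(fun h => cvgB h (@cvg_cst R^o (\sum_(0 <= i < n) t i * f (z i)) _ _ _)).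
move=> /(@cvg_norm _ R^o) h.
apply: (@closed_cvg _ R^o _ _ _ [set x | x <= d] _ _ _ h).
  exact: closed_le.
near=> m => /=.
have nm : (n <= m)%N by near: m; exact: nbhs_infty_ge.
rewrite fctE (big_cat_nat (leq0n n) nm)//= addrC addKr.
apply: (le_trans (ler_norm_sum _ _ _)).
apply: (@le_trans _ _ (\sum_(n <= i < m) t i * d)).
  rewrite big_nat [leRHS]big_nat; apply: ler_sum => i /andP[ni _].
  by rewrite normrM ger0_norm ?wt.1// ler_wpM2l ?wt.1// fd.
rewrite -mulr_suml ler_piMl//.
apply: le_trans (wt.2 m); rewrite (big_cat_nat (leq0n n) nm)//= lerDr.
by apply: sumr_ge0 => i _; exact: wt.1.
Unshelve. all: by end_near.
Qed.

Lemma e_cont n : continuous (e n).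
Proof. exact: linear_bounded_cont (eM n). Qed.

(** Both sides are the tail sum of the [t i] with [n <= i], since [e n] is 1 on exactly those
    [z i]. *)
Lemma represents_e t x n : represents t x ->
  e n (x - x0) = e 0%N (x - x0) - \sum_(0 <= i < n) t i.
Proof.
move=> tx.
have h0 := represents_eval tx (@e_cont 0%N).
have hn := represents_eval tx (@e_cont n).
apply: (@cvg_unique _ (@norm_hausdorff R R^o) _ _ _ _ hn).
have := cvgB h0 (@cvg_cst R^o (\sum_(0 <= i < n) t i) _ _ _).
move=> cvh.
apply: (eventually_eq_cvg (N:=n) _ (cvh _ _)) => m nm /=.
rewrite fctE !(big_cat_nat (leq0n n) nm)//=.
have -> : \sum_(0 <= i < n) t i * e 0%N (z i) = \sum_(0 <= i < n) t i.
  by apply: eq_bigr => i _; rewrite ez mulr1.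
have -> : \sum_(0 <= i < n) t i * e n (z i) = 0.
  rewrite big_nat; apply: big1 => i /andP[_ ni].
  by rewrite ez leqNgt ni mulr0.
rewrite addrC addrA addNr !add0r; rewrite !big_nat; apply: eq_bigr => i /andP[ni _].
by rewrite !ez ni.
Unshelve. all: by end_near.
Qed.

Lemma represents_e_cvg t x : represents t x ->
  (fun n => e n (x - x0) : R^o) @ \oo --> (0 : R^o).
Proof.
move=> tx; have h0 := represents_eval tx (@e_cont 0%N).
have := cvgB (@cvg_cst R^o (e 0%N (x - x0)) _ _ _) h0.
rewrite subrr; move=> cvh.
apply: (eventually_eq_cvg (N:=0%N) _ (cvh _ _)) => n _ /=.
rewrite fctE (represents_e n tx); congr (_ - _).
by apply: eq_bigr => i _; rewrite ez mulr1.
Qed.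

Lemma represents_e_ge0 t x n : represents t x -> 0 <= e n (x - x0) :> R.
Proof.
move=> tx; have h := represents_eval tx (@e_cont n).
apply: (@closed_cvg _ R^o _ _ _ [set x | 0 <= x] _ _ _ h).
  exact: closed_ge.
apply: nearW => m /=; apply: sumr_ge0 => i _.
by rewrite ez mulr_ge0 ?ler0n ?tx.1.1.
Qed.

Lemma represents_e0_le1 t x : represents t x -> e 0%N (x - x0) <= 1 :> R.
Proof.
move=> tx; have h0 := represents_eval tx (@e_cont 0%N).
apply: (@closed_cvg _ R^o _ _ _ [set x | x <= 1] _ _ _ h0).
  exact: closed_le.
apply: nearW => n /=; apply: le_trans (tx.1.2 n).
by apply: ler_sum => i _; rewrite ez mulr1.
Qed.


(** [c] is the weighted mean of the points [x0 + z i], updated one vertex at a time; if the total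
    weight is 0, [x0] serves. Hence [x0] plus the partial sum is a convex combination of [c] and
    [x0]. *)
Lemma partial_sum_in_C t n : weights t ->
  exists2 c, C c & \sum_(0 <= i < n) t i *: z i =
    (\sum_(0 <= i < n) t i) *: (c - x0).
Proof.
move=> [t0 _]; elim: n => [|n [c Cc' IH]].
  by exists x0 => //; rewrite !big_geq// scale0r.
rewrite !big_nat_recr//= IH; set s := \sum_(0 <= i < n) t i.
have s0 : 0 <= s by apply: sumr_ge0 => i _.
have [st|st] := eqVneq (s + t n) 0.
  exists x0 => //.
  have [-> ->] : s = 0 /\ t n = 0 by have := t0 n; split; lra.
  by rewrite !(scale0r, addr0).
have st0 : 0 < s + t n by rewrite lt_neqAle eq_sym st addr_ge0.
exists (s / (s + t n) *: c + (1 - s / (s + t n)) *: (x0 + z n)).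
  move/convex_setP: Cc; apply => //; first by rewrite divr_ge0// ltW.
  by rewrite ler_pdivrMr// mul1r lerDl.
rewrite [RHS]scalerBr [in RHS]scalerDr !scalerA.
have -> : (s + t n) * (s / (s + t n)) = s by field.
have -> : (s + t n) * (1 - s / (s + t n)) = t n by field.
rewrite scalerBr scalerDr scalerDl opprD -[LHS]addrA -[RHS]addrA; congr (_ + _).
by rewrite [X in _ = _ + X]addrC addrACA subrr add0r addrC.
Qed.

Lemma simplex_subset : simplex `<=` C.
Proof.
move=> x [t [wt tx]].
have h : (fun n => 1 *: series (fun n => t n *: z n) n + 1 *: x0) @ \oo --> x.
  have -> : x = 1 *: (x - x0) + 1 *: x0 by rewrite !scale1r subrK.
  by apply: cvg_comb => //; exact: cvg_cst.
apply: (@closed_cvg _ X _ _ _ C Ccl _ _ h); apply: nearW => n /=.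
rewrite !scale1r /series/=; have [c Cc' ->] := partial_sum_in_C n wt.
set s := \sum_(_ <= _ < _) _.
have -> : s *: (c - x0) + x0 = s *: c + (1 - s) *: x0.
  by rewrite scalerBr scalerBl scale1r addrAC -addrA.
by move/convex_setP: Cc; apply=> //; [apply: sumr_ge0 => i _; exact: wt.1|exact: wt.2].
Qed.

Lemma simplex_convex : convex_set simplex.
Proof.
apply/convex_setP => x y a [t [wt tx]] [t' [wt' ty]] a0 a1.
have a1' : 0 <= 1 - a by rewrite subr_ge0.
exists (fun n => a * t n + (1 - a) * t' n); split; first split.
- by move=> n; rewrite addr_ge0// mulr_ge0//; [exact: wt.1|exact: wt'.1].
- move=> n; rewrite big_split/= -!mulr_sumr.
  have := ler_wpM2l a0 (wt.2 n); have := ler_wpM2l a1' (wt'.2 n); lra.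
- have := cvg_comb (a := a) (b := 1 - a) tx ty; rewrite -convex_combB => h.
  apply: (eventually_eq_cvg (N:=0%N) _ h) => n _.
  rewrite /series/= !scaler_sumr -big_split/=; apply: eq_bigr => i _.
  by rewrite !scalerA -scalerDl.
Qed.

Lemma represents_coord t x n : represents t x ->
  e n (x - x0) - e n.+1 (x - x0) = t n :> R.
Proof.
move=> tx; rewrite (represents_e n tx) (represents_e n.+1 tx).
by rewrite big_nat_recr//=; ring.
Qed.

Lemma weight_le1 t n : weights t -> t n <= 1.
Proof.
move=> wt; apply: le_trans (wt.2 n.+1); rewrite big_nat_recr//= lerDr.
by apply: sumr_ge0 => i _; exact: wt.1.
Qed.

Local Notation tau := (seminorm_topology (abs_sum_directed N)).

(** Along an ultrafilter the coordinates converge to numbers that are again weights; mass that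
    escapes to infinity goes to [x0], the limit of the vertices. Convergence of the coordinates
    suffices by [represents_tail]. *)
Lemma simplex_compact : @compact (retopologized tau) simplex.
Proof.
rewrite compact_ultra => F FU FK; have FF := @ultra_proper _ _ FU.
pose h n x : R := e n (x - x0) - e n.+1 (x - x0).
have hb n : F [set x | `|h n x| <= 1].
  apply: filterS FK => x [t tx] /=; rewrite /h (represents_coord n tx).
  by rewrite ger0_norm ?tx.1.1// weight_le1//; exact: tx.1.
pose th n := sval (cid (ultra_bounded_cvg FU (hb n))).
have thP n : h n @ F --> th n by rewrite /th; case: cid.
have thS (c : nat -> R) n : (fun x => \sum_(0 <= i < n) h i x * c i) @ F -->
    \sum_(0 <= i < n) th i * c i.
  elim: n => [|n IH].
    rewrite big_geq//; under eq_fun do rewrite big_geq//; exact: cvg_cst.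
  rewrite big_nat_recr//=; under eq_fun do rewrite big_nat_recr//=.
  by apply: cvgD => //; apply: cvgM => //; exact: cvg_cst.
have wth : weights th.
  split=> n.
    apply: (@closed_cvg _ R^o _ _ _ [set x | 0 <= x] _ _ _ (thP n)).
      exact: closed_ge.
    by apply: filterS FK => x [t tx] /=; rewrite /h (represents_coord n tx) tx.1.1.
  have := thS (fun=> 1) n; rewrite -mulr_suml mulr1 => thn.
  apply: (@closed_cvg _ R^o _ _ _ [set x | x <= 1] _ _ _ thn).
    exact: closed_le.
  apply: filterS FK => x [t tx] /=; rewrite -mulr_suml mulr1.
  by under eq_bigr do rewrite /h (represents_coord _ tx); exact: tx.1.2.
have [p pth] := represents_ex wth.
exists p; split; first by exists th.
move=> A /seminorm_nbhsP[q [d [sq d0 qA]]].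
suff H : forall d : R, 0 < d -> F [set y | q (y - p) < d].
  by apply: filterS (H d d0) => y /= /qA.
elim: sq {d d0 qA} => [|f r Nf sr IH] d d0; first by apply: filterS filterT => y _.
have d20 : 0 < d / 2 by rewrite divr_gt0.
(* Two tail errors and one error on finitely many coordinates give [3 * d / 8 < d / 2]; the other
   half of [d] is for the remaining seminorm [r]. *)
have d80 : 0 < d / 8 by rewrite divr_gt0.
suff Ff : F [set y | `|f (y - p) : R| < d / 2].
  apply: filterS (filterI Ff (IH _ d20)) => y [/= h1 h2].
  by rewrite [d]splitr ltrD.
have [fc /(@cvgr0_norm_lt _ R^o) f0] := Nf.
have [n _ fn] := f0 _ d80.
have fn' i : (n <= i)%N -> `|f (z i) : R| <= d / 8.
  by move=> ni; apply: ltW; exact: fn.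
have hp := represents_tail pth fc fn'.
have := thS (fun i => f (z i) : R) n => /cvgrPdist_lt/(_ _ d80) hF.
have hF' : F (fun y => `|\sum_(0 <= i < n) th i * (f (z i) : R) -
  \sum_(0 <= i < n) h i y * (f (z i) : R)| < d / 8) by exact: hF.
apply: filterS (filterI FK hF') => y [[t ty] /=].
have -> : \sum_(0 <= i < n) h i y * f (z i) = \sum_(0 <= i < n) t i * f (z i).
  by apply: eq_bigr => i _; rewrite /h (represents_coord i ty).
have hy := represents_tail ty fc fn'.
have -> : y - p = (y - x0) - (p - x0) by rewrite opprB addrA subrK.
rewrite linearB.
move: hp hy.
set a := \sum_(_ <= _ < _) _; set b := \sum_(_ <= _ < _) _.
set u : R := f (y - x0); set v : R := f (p - x0) => hp hy ab.
have -> : u - v = (u - b) - (v - a) - (a - b) by ring.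
have := ler_normB ((u - b) - (v - a)) (a - b).
have := ler_normB (u - b) (v - a).
move: hp hy ab; rewrite -/u -/v; lra.
Qed.

Lemma simplex_calK : calTw tau -> calK tau C simplex.
Proof.
move=> [tauH _ tauw]; split; last exact: simplex_compact.
split.
- have w0 : weights (fun=> 0) by split=> n //; rewrite big1.
  by have [x ?] := represents_ex w0; exists x, (fun=> 0).
- have [m [mr Cm]] := Cb; exists m; split => // k mk x /simplex_subset.
  exact: Cm.
(* Norm closedness: a compact set is closed in the Hausdorff topology [tau], and balls of an
   [abs_sum] are norm neighbourhoods. *)
- have := compact_closed tauH simplex_compact.
  rewrite -openC -[X in _ -> X]openC => oK.
  have {}oK : seminorm_open (abs_sum N) (~` simplex) := oK.
  rewrite openE => x /oK[q [d [sq d0 qK]]].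
  suff : nbhs x [set y | q (y - x) < d] by apply: filterS => y /qK.
  elim: sq d d0 {oK qK} => [|f r [fc _] sr IH] d d0.
    by apply: filterS filterT => y _.
  have d20 : 0 < d / 2 by rewrite divr_gt0.
  have := fc x _ (@nbhsx_ballx _ R^o (f x) _ d20).
  move=> /(filterI (IH _ d20)); apply: filterS => y [/= h1 h2].
  by rewrite linearB distrC addrC [d]splitr ltrD.
- exact: simplex_convex.
- exact: simplex_subset.
Qed.


(** * The slow shift of the simplex *)

Section Shift.
Variable B : R.
Hypotheses (M0 : 0 < M) (B0 : 0 < B) (zB : forall n, `|z n| <= B).

(* Vertex 0 of the simplex is x0, with barycentric tail 1; vertex n.+1 is
   x0 + z n. *)
Let tail n (x : X) : R := if n is m.+1 then e m (x - x0) else 1.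
Let vertex n : X := if n is m.+1 then z m else 0.
(** The [eps n] sum to at most [kappa]. The term [8 * M * B] makes the Lipschitz constant
    [kappa * (4 * M * B)] of [W] at most 1/2, and the term 2 ensures [eps n <= 1]. *)
Let kappa : R := (8 * M * B + 2)^-1.
Let eps n : R := kappa * 2%:R ^- n.+1.
(** On the simplex the difference of tails is the barycentric weight of vertex [n], so this is the
    mass moved to vertex [n.+1]. Written with functionals rather than weights, it is defined and
    affine on all of [X]. *)
Let mass n x : R := eps n * (tail n x - tail n.+1 x).
Let drift x n : X := mass n x *: (vertex n.+1 - vertex n).

Let kappa_gt0 : 0 < kappa.
Proof. by rewrite invr_gt0 addr_gt0// !mulr_gt0. Qed.

Let eps_gt0 n : 0 < eps n.
Proof. by rewrite mulr_gt0// invr_gt0 exprn_gt0. Qed.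

Let eps_sum n : \sum_(0 <= i < n) eps i <= kappa.
Proof.
by rewrite -mulr_sumr sum_half_powers ger_pMr// lerBlDr lerDl.
Qed.

Let eps_le1 n : eps n <= 1.
Proof.
have h : kappa <= 1.
  rewrite invf_le1 ?addr_gt0 ?mulr_gt0//.
  have : 0 < 8 * M * B by rewrite !mulr_gt0.
  lra.
apply: le_trans h; apply: le_trans (eps_sum n.+1).
rewrite big_nat_recr//= lerDr; apply: sumr_ge0 => i _; exact: ltW.
Qed.

Let vertexB n : `|vertex n.+1 - vertex n| <= 2 * B.
Proof.
apply: (le_trans (ler_normB _ _)); have := zB n.
rewrite /vertex; case: n => [|n]; first by rewrite normr0 addr0; move: B0; lra.
have := zB n; lra.
Qed.

Let tail_lip n x y : `|tail n x - tail n y| <= M * `|x - y|.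
Proof.
rewrite /tail; case: n => [|n]; first by rewrite subrr normr0 mulr_ge0// ltW.
have -> : e n (x - x0) - e n (y - x0) = e n (x - y).
  by rewrite -linearB opprB addrA subrK.
exact: eM.
Qed.

Let drift_lip n x y :
  `|drift x n - drift y n| <= eps n * (4 * M * B * `|x - y|).
Proof.
rewrite /drift -scalerBl normrZ.
have -> : mass n x - mass n y =
   eps n * ((tail n x - tail n y) - (tail n.+1 x - tail n.+1 y)).
  by rewrite /mass; ring.
rewrite normrM (ger0_norm (ltW (eps_gt0 n))) -[leLHS]mulrA ler_wpM2l ?(ltW (eps_gt0 n))//.
have -> : 4 * M * B * `|x - y| = (M * `|x - y| + M * `|x - y|) * (2 * B) by ring.
rewrite ler_pM//; apply: (le_trans (ler_normB _ _)).
by rewrite lerD// tail_lip.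
Qed.

Let driftx0 n : `|drift x0 n| <= eps n * (2 * B).
Proof.
rewrite normrZ normrM (ger0_norm (ltW (eps_gt0 n))) -[leLHS]mulrA.
rewrite ler_wpM2l ?(ltW (eps_gt0 n))// -[leRHS]mul1r ler_pM//.
by rewrite /tail subrr; case: n => [|n]; rewrite !linear0 addr0 ?normr1 ?normr0.
Qed.

Let cvg_drift x : cvgn (series (drift x)).
Proof.
(* The Lipschitz bound between [x] and [x0], plus the direct bound on [drift x0]. *)
pose c := 4 * M * B * `|x - x0| + 2 * B.
have c0 : 0 <= c.
  by rewrite addr_ge0// ?mulr_ge0 ?(ltW M0) ?(ltW B0).
have [|n|l xl _] := @absolutely_summable_cvg R X (drift x)
   (fun n => eps n * c) (kappa * c); last by apply/cvg_ex; exists l.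
  move=> n; rewrite -[drift x n](subrK (drift x0 n)).
  by apply: (le_trans (ler_normD _ _)); rewrite /c mulrDr lerD.
by rewrite -mulr_suml ler_wpM2r.
Qed.

Let W x : X := limn (series (drift x)).

Let cvg_W x : series (drift x) @ \oo --> W x.
Proof. exact: cvg_drift. Qed.

Let W_lip x y : `|W x - W y| <= 2^-1 * `|x - y|.
Proof.
have [n|n|l xl lB] := @absolutely_summable_cvg R X (fun n => drift x n - drift y n)
   (fun n => eps n * (4 * M * B * `|x - y|)) (kappa * (4 * M * B * `|x - y|)).
- exact: drift_lip.
- rewrite -mulr_suml ler_wpM2r// !mulr_ge0// ltW//.
- have h : (fun n => 1 *: series (drift x) n + (-1) *: series (drift y) n)
       @ \oo --> W x - W y.
    have -> : W x - W y = 1 *: W x + (-1) *: W y by rewrite scale1r scaleN1r.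
    by apply: cvg_comb; exact: cvg_W.
  have h' : (fun n => 1 *: series (drift x) n + (-1) *: series (drift y) n)
       @ \oo --> l.
    apply: (eventually_eq_cvg (N := 0%N) _ xl) => n _.
    by rewrite scale1r scaleN1r /series/= sumrB.
  rewrite (@cvg_unique _ (@norm_hausdorff R X) _ _ _ _ h h').
  apply: (le_trans lB); rewrite mulrA ler_wpM2r// mulrC ler_pdivrMr.
    by have : 0 < M * B; [rewrite mulr_gt0|rewrite -!mulrA; lra].
  by rewrite addr_gt0// !mulr_gt0.
Qed.

Let shift x := x + W x.

Lemma shift_bi_lipschitz : bi_lipschitz_on simplex shift.
Proof.
exists (2^-1), (3 / 2); split; [by rewrite invr_gt0|lra|move=> x y _ _].
have -> : shift x - shift y = (x - y) + (W x - W y) by rewrite opprD addrACA.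
have := ler_normD (x - y) (W x - W y); have := lerB_normD (x - y) (W x - W y).
have := W_lip x y; lra.
Qed.

Let tail_affine n x y (a : R) :
  tail n (a *: x + (1 - a) *: y) = a * tail n x + (1 - a) * tail n y.
Proof.
rewrite /tail; case: n => [|n]; first by ring.
by rewrite convex_combB linearD !linearZ.
Qed.

Lemma shift_affine : affine_on simplex shift.
Proof.
move=> x y _ _ a _; rewrite /shift !scalerDr addrACA; congr (_ + _).
have h := cvg_comb (a := a) (b := 1 - a) (@cvg_W x) (@cvg_W y).
apply: (@cvg_unique _ (@norm_hausdorff R X) _ _ _ _ (@cvg_W _)) => /=.
apply: (eventually_eq_cvg (N := 0%N) _ h) => n _.
rewrite /series/= !scaler_sumr -big_split/=; apply: eq_bigr => i _.
rewrite /drift !scalerA -scalerDl; congr (_ *: _).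
by rewrite /mass !tail_affine; ring.
Qed.

Let tail_diff t x n : represents t x ->
  0 <= tail n x - tail n.+1 x <= 1.
Proof.
move=> tx; rewrite /tail; case: n => [|n].
  have := represents_e0_le1 tx; rewrite subr_ge0 lerBlDr => ->.
  by rewrite lerDl (represents_e_ge0 0%N tx).
by rewrite (represents_coord n tx) tx.1.1 weight_le1//; exact: tx.1.
Qed.

Lemma shift_simplex : set_fun simplex simplex shift.
Proof.
move=> x [t tx]; have wt := tx.1.
have m0 n : 0 <= mass n x.
  by case/andP: (tail_diff n tx) => h _; rewrite mulr_ge0// ltW.
have m1 n : mass n x <= eps n.
  case/andP: (tail_diff n tx) => h h'.
  by rewrite -[leRHS]mulr1 ler_wpM2l// ltW.
have mS n : mass n.+1 x = eps n.+1 * t n.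
  by rewrite /mass /tail (represents_coord n tx).
(* [t n] is the weight of vertex [n.+1], which receives [mass n x] and gives away
   [mass n.+1 x = eps n.+1 * t n <= t n]. *)
exists (fun n => t n + (mass n x - mass n.+1 x)); split; first split.
- move=> n; have := m0 n; have : mass n.+1 x <= t n.
    by rewrite mS -[leRHS]mul1r ler_wpM2r// wt.1.
  lra.
(* The transfers telescope, and [mass 0 x] is at most the weight [1 - e 0 (x - x0)] of [x0], so the
   total stays at most 1. *)
- move=> n; rewrite big_split/=.
  have -> : \sum_(0 <= i < n) (mass i x - mass i.+1 x) = mass 0%N x - mass n x.
    elim: n => [|n IH]; first by rewrite big_geq// subrr.
    by rewrite big_nat_recr//= IH addrA subrK.
  have := represents_e n tx; have := represents_e_ge0 n tx.
  have := m0 n; have := represents_e0_le1 tx.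
  have : mass 0%N x <= 1 - e 0%N (x - x0) :> R.
    rewrite /mass /tail -[leRHS]mul1r ler_wpM2r//.
    by rewrite subr_ge0 (represents_e0_le1 tx).
  by move: (e n _ : R) (e 0%N _ : R) => u v; lra.
(* Summation by parts: as [vertex 0] is 0, the series of the new weights and that of the drift
   differ only by this boundary term. *)
- have mv0 : (fun n => mass n x *: vertex n) @ \oo --> (0 : X).
    apply: norm_cvg0.
    apply: (@squeeze_cvgr _ _ _ R (fun=> 0) (geometric (kappa * B / 2) 2^-1)).
    + apply: nearW => n /=; rewrite normr_ge0/= normrZ (ger0_norm (m0 n)).
      apply: (@le_trans _ _ (eps n * B)).
        rewrite ler_pM// /vertex; case: n => [|n]; first by rewrite normr0 ltW.
        exact: zB.
      by rewrite /eps exprVn exprS invfM le_eqVlt; apply/orP; left; apply/eqP; ring.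
    + exact: cvg_cst.
    + by apply: cvg_geometric; rewrite ger0_norm ?invr_ge0// invf_lt1// ltr1n.
  have h := cvg_comb (a := 1) (b := 1) tx.2 (@cvg_W x).
  have {h} := cvg_comb (a := 1) (b := -1) h mv0.
  rewrite scaler0 addr0 !scale1r addrAC => h.
  apply: (eventually_eq_cvg (N := 0%N) _ h) => n _.
  rewrite !scale1r scaleN1r /series/=; under [RHS]eq_bigr do rewrite scalerDl.
  rewrite big_split/= -addrA; congr (_ + _).
  elim: n => [|n IH]; first by rewrite !big_geq// scaler0 subrr.
  rewrite !big_nat_recr//= -IH /drift scalerBr scalerBl.
  by rewrite -!addrA; congr (_ + _); rewrite addrCA.
Qed.

(** [e k] is 1 on the edge from vertex [k] to vertex [k.+1] and 0 on the other edges, so [W x = 0]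
    forces every [mass k x] to vanish. Then all tails equal 1, although they tend to 0. *)
Lemma shift_no_fixed_point x : simplex x -> shift x <> x.
Proof.
move=> [t tx] /eqP; rewrite -subr_eq0 /shift addrAC subrr add0r => /eqP W0.
have ev k n : e k (vertex n.+1 - vertex n) = (n == k)%:R :> R.
  rewrite linearB /vertex; case: n => [|n].
    by rewrite linear0 subr0 ez leqn0 eq_sym.
  rewrite !ez leq_eqVlt eq_sym ltnS; case: eqP => [<-|_] /=.
    by rewrite ltnn subr0.
  by rewrite subrr.
have mass0 k : mass k x = 0.
  have h : (e k \o series (drift x) : nat -> R^o) @ \oo --> (e k (W x) : R^o).
    apply: (@continuous_cvg _ _ _ _ _ _ (e k : X -> R^o)); first exact: e_cont.
    exact: cvg_W.
  move: h; rewrite W0 linear0 => h.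
  have h' : (fun=> mass k x : R^o) @ \oo --> (0 : R^o).
    apply: (eventually_eq_cvg (N := k.+1) _ h) => n kn.
    rewrite /= /series/= linear_sum (bigD1_seq k)/= ?mem_index_iota ?iota_uniq//.
    have evZ i : e k (drift x i) = mass i x * (i == k)%:R :> R.
      by rewrite -ev linearZ.
    rewrite evZ eqxx mulr1 big1 ?addr0// => i ik.
    by rewrite evZ (negbTE ik) mulr0.
  by rewrite (@cvg_unique _ (@norm_hausdorff R R^o) _ _ _ _ h' (@cvg_cst R^o _ _ _ _)).
have tail1 k : tail k x = 1.
  elim: k => [//|k IH].
  move/eqP: (mass0 k); rewrite mulf_eq0 gt_eqF//= subr_eq0 => /eqP <-.
  exact: IH.
have h := represents_e_cvg tx.
have h' : (fun n => e n (x - x0) : R^o) @ \oo --> (1 : R^o).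
  have -> : (fun n => e n (x - x0) : R^o) = (fun=> 1).
    by apply/funext => n; exact: (tail1 n.+1).
  exact: cvg_cst.
have h01 : (0 : R) = 1 := @cvg_unique _ (@norm_hausdorff R R^o) _ _ _ _ h h'.
by have := oner_neq0 R; rewrite -h01 eqxx.
Qed.

End Shift.

Lemma simplex_not_wG_FPP : 0 < M -> ~ has_wG_FPP affine_bi_lipschitz C.
Proof.
move=> M0 Cfpp; have [B B0 zB] := z_bounded.
have tauT : calTw tau by apply: abs_sum_calTw => // f [].
have [] := Cfpp tau tauT simplex (simplex_calK tauT) _ (shift_simplex M0 B0 zB).
  by split; [exact: shift_affine|exact: shift_bi_lipschitz].
by move=> x Kx; exact: shift_no_fixed_point.
Qed.

End Simplex.

(** * Ultrafilters without weak limit *)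

Lemma norming_functional {R : realType} {X : normedModType R} (y : X) :
  exists f : {linear X -> R^o},
    (forall x, `|f x : R| <= `|x|) /\ f y = `|y| :> R.
Proof.
have [|||f [f1 fy]] := @mazur_separation R X [set y] `|y|.
- by exists y.
- by move=> _ _ t -> -> _ _ /=; rewrite -scalerDl addrC subrK scale1r.
- by move=> _ ->.
exists f; split => //; apply/eqP; rewrite eq_le fy// andbT.
by apply: le_trans (ler_norm _) (f1 y).
Qed.

Section Ultrafilter.
Context {R : realType} {X : completeNormedModType R}.
Variables (C : set X) (U : set_system X).
Hypotheses (UU : UltraFilter U) (UC : U C).
Hypotheses (Cc : convex_set C) (Cb : bounded_set C) (Ccl : closed C).
Hypothesis Unc : forall p, C p -> ~ (U --> (p : @weak_space R X)).

Let UF : ProperFilter U := ultra_proper.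

(** A substitute, without the bidual, for the limit of [U] in X** having distance at least [d] from
    [S]. *)
Definition apart (S : set X) (d : R) := exists A, [/\ convex_set A, U A &
  forall x s, A x -> S s -> d <= `|x - s|].

Lemma apartS S S' d d' : S `<=` S' -> d <= d' -> apart S' d' -> apart S d.
Proof.
move=> SS' dd' [A [Ac UA AS]]; exists A; split => // x s Ax /SS' Ss.
exact: le_trans dd' (AS _ _ Ax Ss).
Qed.

Lemma apartU S S' d : apart S d -> apart S' d -> apart (S `|` S') d.
Proof.
move=> [A [/convex_setP Ac UA AS]] [A' [/convex_setP Ac' UA' AS']].
exists (A `&` A'); split; last 1 first.
- by move=> x s [Ax A'x] []; [exact: AS|exact: AS'].
- by apply/convex_setP => x y t [? ?] [? ?] t0 t1; split; [exact: Ac|exact: Ac'].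
- exact: filterI.
Qed.

Lemma convex_halfspace (f : {linear X -> R^o}) (c : R) :
  convex_set [set x | f x < c :> R].
Proof.
apply/convex_setP => x y t /= fx fy t0 t1; rewrite linearD !linearZ /=.
have [->|tn0] := eqVneq t 0; first by rewrite scale0r add0r subr0 scale1r.
have tp : 0 < t by rewrite lt_neqAle eq_sym tn0.
have t1' : 0 <= 1 - t by rewrite subr_ge0.
have h1 : t * f x < t * c by rewrite ltr_pM2l.
have h2 : (1 - t) * f y <= (1 - t) * c by rewrite ler_wpM2l// ltW.
have := ltr_leD h1 h2; rewrite -mulrDl [t + _]addrC subrK mul1r.
by [].
Qed.

Lemma convex_halfspaceC (f : {linear X -> R^o}) (c : R) :
  convex_set (~` [set x | f x < c :> R]).
Proof.
apply/convex_setP => x y t /= /negP fx /negP fy t0 t1.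
apply/negP; move: fx fy; rewrite -!leNgt linearD !linearZ /= => fx fy.
have t1' : 0 <= 1 - t by rewrite subr_ge0.
have := lerD (ler_wpM2l t0 fx) (ler_wpM2l t1' fy).
by rewrite -mulrDl [t + _]addrC subrK mul1r.
Qed.

(** Otherwise take a norming functional of [y - y']. The half-space where it is below [f y - d] is
    [d]-apart from [y], its complement is [d']-apart from [y']; both are convex and one belongs to
    [U]. *)
Lemma not_apart_close y y' (d d' : R) :
  ~ apart [set y] d -> ~ apart [set y'] d' -> `|y - y'| <= d + d'.
Proof.
move=> yd yd'; rewrite leNgt; apply/negP => dd'.
have [f [f1 fy]] := norming_functional (y - y').
have [HU|HU] := in_ultra_setVsetC [set x | f x < f y - d :> R] UU.
  apply: yd; exists [set x | f x < f y - d :> R]; split => //.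
    exact: convex_halfspace.
  move=> x _ /= fx ->; have := f1 (y - x); rewrite linearB [leRHS]distrC.
  have := ler_norm (f y - f x : R); lra.
apply: yd'; exists (~` [set x | f x < f y - d :> R]); split => //.
  exact: convex_halfspaceC.
move=> x s /= /negP; rewrite -leNgt => fx ->; have := f1 (x - y').
rewrite linearB; have := ler_norm (f x - f y' : R).
by move: fy dd'; rewrite linearB => <-; lra.
Qed.

(* Otherwise points close to every convex set of the ultrafilter form a Cauchy
   sequence, whose limit is a weak limit of the ultrafilter. *)
Lemma ultrafilter_apart_point : exists2 d, 0 < d & forall y, apart [set y] d.
Proof.
apply: contrapT => nd.
have H (d : R) : 0 < d -> exists y, ~ apart [set y] d.
  move=> d0; apply: contrapT => ny; apply: nd; exists d => // y.
  by apply: contrapT => nyd; apply: ny; exists y.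
have h0 n : (0 : R) < 2 ^- n.+1 by rewrite invr_gt0 exprn_gt0.
pose y n := sval (cid (H _ (h0 n))).
have yP n : ~ apart [set y n] (2 ^- n.+1) by rewrite /y; case: cid.
have [n|n|l yl _] := @absolutely_summable_cvg R X (fun n => y n.+1 - y n)
   (fun n => 2 * 2 ^- n.+1) 2.
- apply: (le_trans (not_apart_close (yP _) (yP _))).
  have : (2 : R) ^- n.+2 <= 2 ^- n.+1.
    by rewrite lef_pV2 ?posrE ?exprn_gt0// ler_eXn2l// ltr1n.
  lra.
- by rewrite -mulr_sumr sum_half_powers ger_pMr// lerBlDr lerDl.
pose p := l + y 0%N.
have {}yl : y @ \oo --> p.
  have h := cvg_comb (a := 1) (b := 1) yl (@cvg_cst X (y 0%N) _ _ _).
  rewrite -[p]/(l + y 0%N) -[l]scale1r -[y 0%N]scale1r.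
  apply: (eventually_eq_cvg (N := 0%N) _ (h _)) => n _.
  by rewrite !scale1r /series/= telescope_sumr// subrK.
(* The limit [p] lies in the norm closure of every convex set of [U]; for [A = C] this puts [p] in
   [C]. *)
have pA A (e : R) : convex_set A -> U A -> 0 < e -> exists2 x, A x & `|x - p| < e.
  move=> Ac UA e0; apply: contrapT => nx.
  have e20 : 0 < e / 2 by rewrite divr_gt0.
  have hp := near_half_power_lt 1 e20.
  have hy := cvgr_dist_lt _ _ yl _ e20.
  have [n [/= hn1 hn2]] := filter_ex (filterI hp (hy _)).
  apply: (yP n); exists A; split => // x _ Ax ->.
  rewrite leNgt; apply/negP => xy; apply: nx; exists x => //.
  have -> : x - p = (x - y n) - (p - y n) by rewrite opprB addrA subrK.
  have := ler_normB (x - y n) (p - y n); lra.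
have Cp : C p.
  have /closure_id -> := Ccl; move=> B /nbhs_ballP[e /= e0 eB].
  have [x Cx xp] := pA C e Cc UC e0.
  by exists x; split => //; apply: eB; rewrite -ball_normE /= distrC.
apply: (Unc Cp); apply: weak_cvgP => f fc e e0.
have /nbhs_ballP[d /= d0 dB] := fc p _ (@nbhsx_ballx _ R^o (f p) e e0).
have fe x : `|x - p| < d -> `|f p - f x : R| < e.
  by move=> xp; apply: dB; rewrite -ball_normE /= distrC.
(* By [pA], [U] contains no half-space that stays away from [p], hence it contains the complementary
   ones. Below [p] the margin is [e / 2], since the complement only gives a weak inequality. *)
have h1 : U [set x | f x < f p + e :> R].
  have [//|HU] := in_ultra_setVsetC [set x | f x < f p + e :> R] UU.
  have [x /= /negP + /fe] := pA _ d (@convex_halfspaceC f (f p + e)) HU d0.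
  rewrite -leNgt; have := ler_norm (- (f p - f x) : R); rewrite normrN; lra.
have h2 : U (~` [set x | f x < f p - e / 2 :> R]).
  have [HU|//] := in_ultra_setVsetC [set x | f x < f p - e / 2 :> R] UU.
  have e20 : 0 < e / 2 by rewrite divr_gt0.
  have /nbhs_ballP[c /= c0 cB] := fc p _ (@nbhsx_ballx _ R^o (f p) _ e20).
  have [x /= xf xp] := pA _ c (@convex_halfspace f (f p - e / 2)) HU c0.
  have : `|f p - f x : R| < e / 2.
    by apply: cB; rewrite -ball_normE /= distrC.
  have := ler_norm (f p - f x : R); lra.
apply: filterS (filterI h1 h2) => x [/= hx1 /negP]; rewrite -leNgt => hx2.
rewrite ltr_norml; apply/andP; split; lra.
Qed.

(** * Separation of the ultrafilter from finite-dimensional affine subspaces *)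

Fixpoint lin_span (zs : seq X) : set X :=
  if zs is z :: zs' then [set w | exists c v, lin_span zs' v /\ w = c *: z + v]
  else [set 0].

Lemma lin_span0 zs : lin_span zs 0.
Proof.
elim: zs => [//|z zs IH] /=; exists 0, 0; split => //.
by rewrite scale0r addr0.
Qed.

Lemma lin_spanD zs x y : lin_span zs x -> lin_span zs y -> lin_span zs (x + y).
Proof.
elim: zs x y => [x y /= -> ->|z zs IH x y /=]; first by rewrite addr0.
move=> [a [v [zv ->]]] [b [w [zw ->]]]; exists (a + b), (v + w).
by split; [exact: IH|rewrite scalerDl addrACA].
Qed.

Lemma lin_spanZ zs a x : lin_span zs x -> lin_span zs (a *: x).
Proof.
elim: zs x => [x /= ->|z zs IH x /=]; first by rewrite scaler0.
move=> [b [v [zv ->]]]; exists (a * b), (a *: v).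
by split; [exact: IH|rewrite scalerDr scalerA].
Qed.

Lemma lin_span_mem zs z : z \in zs -> lin_span zs z.
Proof.
elim: zs => [//|y zs IH] /=; rewrite inE => /orP[/eqP ->|/IH zz].
  by exists 1, 0; rewrite scale1r addr0; split => //; exact: lin_span0.
by exists 0, z; rewrite scale0r add0r.
Qed.

Variables (d : R) (x0 : X).
Hypotheses (d0 : 0 < d) (Ud : forall y, apart [set y] d).
Hypothesis Cx0 : C x0.

(** Cut the segment into [n] pieces of parameter length [h]. Moving within a piece costs at most
    [h * |z|], and [apartU] joins the finitely many pieces. *)
Lemma apart_segment (zs : seq X) z y (d1 d2 h : R) n :
  (forall y, apart [set y + w | w in lin_span zs] d2) ->
  0 <= h -> d1 + h * `|z| <= d2 ->
  apart [set y + c *: z + w | c in [set c | 0 <= c <= n%:R * h] & w in lin_span zs] d1.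
Proof.
move=> Hd h0 hd; elim: n y => [|n IH] y.
  apply: apartS (Hd y); last first.
    by apply: le_trans hd; rewrite lerDl mulr_ge0.
  move=> s [c /=]; rewrite mul0r => c0 [w zw <-]; exists w => //.
  have -> : c = 0 by apply/eqP; rewrite eq_le andbC.
  by rewrite scale0r addr0.
have hn : apart [set y + c *: z + w | c in [set c | n%:R * h <= c <= n.+1%:R * h]
    & w in lin_span zs] d1.
  have [A [Ac UA AS]] := Hd (y + (n%:R * h) *: z).
  exists A; split => // x s Ax [c /= /andP[c1 c2] [w zw <-]].
  have := AS x (y + (n%:R * h) *: z + w) Ax; move=> /(_ _).
  have hw : [set y + (n%:R * h) *: z + w | w in lin_span zs] (y + (n%:R * h) *: z + w).
    by exists w.
  move=> /(_ hw) h1.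
  have h2 : `|(c - n%:R * h) *: z| <= h * `|z|.
    rewrite normrZ ler_wpM2r// ger0_norm ?subr_ge0// lerBlDr.
    by apply: (le_trans c2); rewrite -natr1 mulrDl mul1r addrC.
  have E : x - (y + (n%:R * h) *: z + w) =
      (x - (y + c *: z + w)) + (c - n%:R * h) *: z.
    rewrite scalerBl; set a := _ *: z; set b := _ *: z.
    rewrite -[RHS]addrA; congr (_ + _).
    rewrite -[b - a]opprB -opprD; congr (- _).
    by rewrite [y + b + w]addrAC -[RHS]addrA [b + (a - b)]addrCA subrr addr0 addrAC.
  have := ler_normD (x - (y + c *: z + w)) ((c - n%:R * h) *: z).
  rewrite -E; lra.
apply: apartS (apartU (IH y) hn) => // _ [c /= /andP[c1 c2] [w zw <-]].
have [cn|/ltW cn] := leP c (n%:R * h); [left|right].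
  by exists c; [rewrite /= c1|exists w].
by exists c; [rewrite /= cn|exists w].
Qed.

(** Vectors are added one at a time, giving up part of the slack [d - d1] at each. If [z] is at
    positive distance from the earlier span, large multiples of [z] leave the bounded set [C] and
    the others form a segment; if not, [z] is approximated from that span. *)
Lemma apart_lin_span zs d1 y : d1 < d ->
  apart [set y + w | w in lin_span zs] d1.
Proof.
have [B B0 CB] := bounded_set_norm Cb.
elim: zs d1 y => [|z zs IH] d1 y d1d.
  by apply: apartS (ltW d1d) (Ud y) => _ [w /= -> <-]; rewrite addr0.
pose d2 := (d1 + d) / 2.
have d2d : d2 < d by rewrite /d2; lra.
have d12 : 0 < d2 - d1 by rewrite /d2; lra.
have {}IH y' : apart [set y' + w | w in lin_span zs] d2 by exact: IH.
have [[e e0 ze]|nze] :=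
    pselect (exists2 e, 0 < e & forall v, lin_span zs v -> e <= `|z - v|).
  pose h := (d2 - d1) / (`|z| + 1).
  have z1 : 0 < `|z| + 1 by rewrite ltr_wpDl.
  have h0 : 0 < h by rewrite divr_gt0.
  have hz : d1 + h * `|z| <= d2.
    rewrite -lerBrDl -[leRHS](@divfK _ (`|z| + 1)) ?gt_eqF// -/h.
    by rewrite ler_pM2l// lerDl.
  (* For [|c| > K] the vector [c *: z + v] has norm at least [|c| * e > B + |y| + d], too far from
     [C]. The coefficients in [[- K, K]] are covered by a segment starting at [y - K *: z]. *)
  pose K := (B + `|y| + d) / e.
  have K0 : 0 < K by rewrite divr_gt0// ltr_wpDl// addr_ge0// ltW.
  pose n := Num.bound (2 * K / h).
  have nK : 2 * K <= n%:R * h.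
    rewrite -ler_pdivrMr//; apply: ltW; rewrite archi_boundP// divr_ge0// ?ltW//.
    by rewrite mulr_gt0.
  have [A [Ac UA AS]] := apart_segment (y - K *: z) n IH (ltW h0) hz.
  exists (A `&` C); split; last 1 first.
  - move=> x s [Ax Cx] [_ [c [v [zv ->]]] <-].
    have [cK|cK] := leP `|c| K.
      move: cK; rewrite ler_norml => /andP[cK1 cK2].
      apply: AS => //; exists (c + K).
        by rewrite /=; apply/andP; split; lra.
      exists v => //; rewrite scalerDl [c *: z + K *: z]addrC addrA subrK.
      by rewrite addrA.
    have c0 : 0 < `|c| by exact: lt_trans K0 cK.
    have h1 : `|c| * e <= `|c *: z + v|.
      have -> : c *: z + v = c *: (z - (- c^-1) *: v).
        by rewrite scaleNr opprK scalerDr scalerA divff ?scale1r// -normr_gt0.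
      by rewrite normrZ ler_pM2l//; apply: ze; exact: lin_spanZ.
    have h2 : B + `|y| + d < `|c| * e by rewrite -ltr_pdivrMr.
    have := CB _ Cx.
    have E : c *: z + v = (x - y) - (x - (y + (c *: z + v))).
      by rewrite opprB [RHS]addrC addrA subrK addrAC subrr add0r.
    have := ler_normB (x - y) (x - (y + (c *: z + v))); rewrite -E.
    have := ler_normB x y; lra.
  - apply/convex_setP => u v t [Au Cu] [Av Cv] t0 t1; split.
      by move/convex_setP: Ac; apply.
    by move/convex_setP: Cc; apply.
  - exact: filterI.
have [A [Ac UA AS]] := IH y.
exists A; split => // x s Ax [_ [c [v [zv ->]]] <-].
(* Replacing [z] by a point of the earlier span within [e] moves [c *: z] by at most [d2 - d1]. The
   set [A] itself is independent of [c]. *)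
pose e := (d2 - d1) / (`|c| + 1).
have c1 : 0 < `|c| + 1 by rewrite ltr_wpDl.
have e0 : 0 < e by rewrite divr_gt0.
have [v' zv' ve] : exists2 v', lin_span zs v' & `|z - v'| < e.
  apply: contrapT => nv; apply: nze; exists e => // v' zv'.
  by rewrite leNgt; apply/negP => ?; apply: nv; exists v'.
have hw : lin_span zs (c *: v' + v) by apply: lin_spanD => //; exact: lin_spanZ.
have := AS x (y + (c *: v' + v)) Ax (ex_intro2 _ _ _ hw erefl).
have h1 : `|c *: (z - v')| <= d2 - d1.
  rewrite normrZ -[leRHS](@divfK _ (`|c| + 1)) ?gt_eqF// -/e mulrC.
  by rewrite ler_pM ?(ltW ve)// lerDl.
have -> : x - (y + (c *: v' + v)) = (x - (y + (c *: z + v))) + c *: (z - v').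
  rewrite scalerBr; set a := _ *: v'; set b := _ *: z.
  rewrite -[RHS]addrA; congr (_ + _).
  rewrite -[b - a]opprB -opprD; congr (- _).
  by rewrite -[RHS]addrA; congr (_ + _); rewrite addrAC addrCA subrr addr0.
have := ler_normD (x - (y + (c *: z + v))) (c *: (z - v')); lra.
Qed.

Lemma ultrafilter_functional_cvg (f : {linear X -> R^o}) (L : R) : 0 <= L ->
  (forall x, `|f x : R| <= L * `|x|) ->
  exists l : R, (fun x => f (x - x0) : R) @ U --> l.
Proof.
move=> L0 fL; have [B B0 CB] := bounded_set_norm Cb.
apply: (@ultra_bounded_cvg _ _ _ _ (L * (B + B))) => //.
apply: filterS UC => x Cx /=; apply: le_trans (fL _) _.
by rewrite ler_wpM2l// (le_trans (ler_normB _ _))// lerD// CB.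
Qed.

(** Separate a convex set of [U] from the affine subspace [x0 + lin_span zs]. A functional bounded
    below along a subspace vanishes on it; dividing by its limit along [U], which is at least
    [d / 2], normalises it. *)
Lemma annihilating_functional zs : exists g : {linear X -> R^o},
  [/\ forall x, `|g x : R| <= 2 / d * `|x|,
      forall w, lin_span zs w -> g w = 0 &
      (fun x => g (x - x0) : R) @ U --> (1 : R)].
Proof.
have d20 : 0 < d / 2 by rewrite divr_gt0.
have [A [/convex_setP Ac UA AS]] : apart [set x0 + w | w in lin_span zs] (d / 2).
  by apply: apart_lin_span; lra.
pose D := [set x - x0 - w | x in A & w in lin_span zs].
have [|||f [f1 fD]] := @mazur_separation R X D (d / 2).
- have [x Ax] := filter_ex UA.
  by exists (x - x0 - 0), x => //; exists 0 => //; exact: lin_span0.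
- move=> _ _ t [x Ax [w zw <-]] [x' Ax' [w' zw' <-]] t0 t1.
  exists (t *: x + (1 - t) *: x'); first exact: Ac.
  exists (t *: w + (1 - t) *: w').
    by apply: lin_spanD; exact: lin_spanZ.
  rewrite !scalerBr [RHS]addrACA -opprD; congr (_ - _).
  by rewrite addrACA -opprD; congr (_ - _); rewrite -scalerDl addrC subrK scale1r.
- move=> _ [x Ax [w zw <-]]; rewrite -addrA -opprD.
  by apply: AS => //; exists w.
have fw w : lin_span zs w -> f w = 0 :> R.
  move=> zw; have [x Ax] := filter_ex UA.
  apply/eqP; apply: contrapT => /negP fw0.
  (* Chosen so that [f (x - x0 - c *: w) = d / 2 - 1], below the bound on [D]. *)
  pose c := (f (x - x0) - d / 2 + 1) / f w : R.
  have : D (x - x0 - c *: w).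
    by exists x => //; exists (c *: w) => //; exact: lin_spanZ.
  move=> /fD; rewrite linearB linearZ /= /c.
  have -> : ((f (x - x0) - d / 2 + 1) / f w) *: f w = f (x - x0) - d / 2 + 1 :> R.
    by rewrite [LHS]divfK.
  lra.
have fA x : A x -> d / 2 <= f (x - x0).
  move=> Ax; have := fD (x - x0 - 0); rewrite subr0; apply.
  by exists x => //; exists 0; rewrite ?subr0//; exact: lin_span0.
have [l fl] : exists l : R, (fun x => f (x - x0) : R) @ U --> l.
  by apply: (@ultrafilter_functional_cvg f 1) => // x; rewrite mul1r.
have l0 : d / 2 <= l.
  apply: (@closed_cvg _ R^o _ _ _ [set x | d / 2 <= x] _ _ _ fl).
    exact: closed_ge.
  exact: filterS UA.
have lp : 0 < l by exact: lt_le_trans l0.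
exists (l^-1 \*: f); split => [x|w zw|] /=.
- rewrite normrM ger0_norm ?invr_ge0 ?(ltW lp)// ler_pM ?invr_ge0 ?(ltW lp)//.
  rewrite -[2 / d]invrK invf_div lef_pV2 ?posrE//.
- by rewrite fw// scaler0.
- rewrite -(@mulVf _ l) ?gt_eqF//.
  by apply: cvgM => //; exact: cvg_cst.
Qed.

End Ultrafilter.

(** * Triangular and biorthogonal sequences *)

Lemma dependent_sequence (T : Type) (P : seq T -> T -> Prop) :
  (forall s, exists x, P s x) -> exists z : nat -> T, forall n, P (mkseq z n) (z n).
Proof.
move=> Pex; pose next s := sval (cid (Pex s)).
have nextP s : P s (next s) by rewrite /next; case: cid.
pose zs := fix zs n := if n is m.+1 then rcons (zs m) (next (zs m)) else [::].
exists (fun n => next (zs n)) => n.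
suff -> : mkseq (fun n => next (zs n)) n = zs n by exact: nextP.
by elim: n => [//|n IH]; rewrite mkseqS IH.
Qed.

Section TriangularSequence.
Context {R : realType} {X : completeNormedModType R}.

(** The coefficient lists form a countable type, so all combinations can be enumerated through
    [pickle]. *)
Definition rat_comb (z : nat -> X) (a : seq rat) : X :=
  \sum_(0 <= i < size a) ratr (nth 0 a i) *: z i.

Variables (C : set X) (U : set_system X).
Hypotheses (UU : UltraFilter U) (UC : U C).
Hypotheses (Cc : convex_set C) (Cb : bounded_set C).
Variables (d : R) (x0 : X).
Hypotheses (d0 : 0 < d) (Ud : forall y, apart U [set y] d).
Hypothesis Cx0 : C x0.

Let UF : ProperFilter U := ultra_proper.

(* The last clause makes norming functionals of the rational combinations of the
   z i converge along z: countably many constraints, enough to separate the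
   points of the closed span of z. *)
Lemma triangular_sequence : exists z (g : nat -> {linear X -> R^o}),
  [/\ forall n, C (x0 + z n),
      forall n x, `|g n x : R| <= 2 / d * `|x|,
      forall n m, (m < n)%N -> g n (z m) = 0 :> R,
      forall n m, (n <= m)%N -> `|1 - g n (z m) : R| < 2 ^- m.+3 &
      forall a : seq rat, exists (f : {linear X -> R^o}) (l : R),
        [/\ forall x, `|f x : R| <= `|x|,
            f (rat_comb z a) = `|rat_comb z a| :> R &
            (fun n => f (z n) : R^o) @ \oo --> (l : R^o)]].
Proof.
have [G GP] := choice (annihilating_functional UU UC Cc Cb d0 Ud Cx0).
have [F FP] := choice (@norming_functional R X).
have limF y : exists l : R, (fun x => F y (x - x0) : R) @ U --> l.
  apply: (@ultrafilter_functional_cvg _ _ _ _ UU UC Cb x0 Cx0 _ 1) => // x.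
  by rewrite mul1r; exact: (FP y).1.
have [th thP] := choice limF.
(* The [j]-th rational combination of the terms chosen so far; numbers that are not codes give the
   empty one. Codes that need later terms give provisional values, corrected in [combE] once [n] is
   large. *)
pose comb (s : seq X) j :=
  let a : seq rat := odflt [::] (unpickle j) in
  rat_comb (fun i => nth 0 s i) a.
pose eta n : R := 2 ^- n.+3.
have eta0 n : 0 < eta n by rewrite invr_gt0 exprn_gt0.
(* Each stage imposes finitely many conditions, each holding on a set of [U]: one for every
   functional attached to a prefix of [s], and one for every code up to [size s]. *)
have [s|z zP] := @dependent_sequence X (fun s x => [/\ C (x0 + x),
   forall k, (k <= size s)%N -> `|1 - G (take k s) x : R| < eta (size s) &
   forall j, (j <= size s)%N -> `|th (comb s j) - F (comb s j) x : R| < eta (size s)]).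
  have h1 : U [set x | forall k : 'I_(size s).+1,
      `|1 - G (take k s) (x - x0) : R| < eta (size s)].
    apply: filter_forall => k; have [_ _ h] := GP (take k s).
    exact: (cvgr_dist_lt _ _ h _ (eta0 _)).
  have h2 : U [set x | forall j : 'I_(size s).+1,
      `|th (comb s j) - F (comb s j) (x - x0) : R| < eta (size s)].
    apply: filter_forall => j; have h := thP (comb s j).
    exact: (cvgr_dist_lt _ _ h _ (eta0 _)).
  have [x [Cx [/= x1 x2]]] := filter_ex (filterI UC (filterI h1 h2)).
  exists (x - x0); split; first by rewrite addrC subrK.
    by move=> k ks; exact: (x1 (Ordinal (ks : (k < (size s).+1)%N))).
  by move=> k ks; exact: (x2 (Ordinal (ks : (k < (size s).+1)%N))).
exists z, (fun n => G (mkseq z n)); split.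
- by move=> n; have [] := zP n.
- by move=> n x; have [] := GP (mkseq z n).
- move=> n m mn; have [_ + _] := GP (mkseq z n); apply.
  by apply: lin_span_mem; apply/mapP; exists m => //; rewrite mem_iota.
- move=> n m nm; have [_ + _] := zP m; rewrite size_mkseq => /(_ n nm).
  suff -> : take n (mkseq z m) = mkseq z n by [].
  by rewrite /mkseq -map_take take_iota (minn_idPl nm).
- move=> a; exists (F (rat_comb z a)), (th (rat_comb z a)).
  have [F1 F2] := FP (rat_comb z a); split => //.
  have combE n : (size a <= n)%N -> comb (mkseq z n) (pickle a) = rat_comb z a.
    move=> an; rewrite /comb pickleK /= /rat_comb; rewrite !big_nat.
    apply: eq_bigr => i /andP[_ ia]; rewrite nth_mkseq//.
    exact: leq_trans an.
  apply/cvgrPdist_lt => e e0.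
  near=> n.
  have an : (size a <= n)%N by near: n; exact: nbhs_infty_ge.
  have pn : (pickle a <= n)%N by near: n; exact: nbhs_infty_ge.
  have [_ _] := zP n; rewrite size_mkseq => /(_ _ pn); rewrite combE// => h.
  by apply: lt_trans h _; near: n; exact: (near_half_power_lt 3).
Unshelve. all: by end_near.
Qed.

End TriangularSequence.

(** * Exact biorthogonality and a separating family of null functionals *)

Section Biorthogonal.
Context {R : realType} {X : completeNormedModType R}.
Variables (z : nat -> X) (g : nat -> {linear X -> R^o}) (M B : R).
Hypotheses (M0 : 0 < M) (B0 : 0 <= B) (zB : forall n, `|z n| <= B).
Hypothesis gM : forall n x, `|g n x : R| <= M * `|x|.
Hypothesis g0 : forall n m, (m < n)%N -> g n (z m) = 0 :> R.
Hypothesis g1 : forall n m, (n <= m)%N -> `|1 - g n (z m) : R| < 2 ^- m.+3.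

Definition comb (V : lmodType R) (F : nat -> V) k (a : nat -> R) : V :=
  \sum_(0 <= i < k) a i *: F i.

Definition finite_combs (V : lmodType R) (F : nat -> V) : set V :=
  [set v | exists k a, v = comb F k a].

Lemma comb_pair (V W : lmodType R) (F : nat -> V * W) k a :
  comb F k a = (comb (fst \o F) k a, comb (snd \o F) k a).
Proof.
elim: k => [|k IH]; first by rewrite /comb !big_geq.
by rewrite /comb !big_nat_recr//= -/(comb _ _ _) IH.
Qed.

Lemma finite_combs_mem (V : lmodType R) (F : nat -> V) n : finite_combs F (F n).
Proof.
exists n.+1, (fun i => (i == n)%:R); rewrite /comb big_nat_recr//=.
rewrite eqxx scale1r big_nat big1 ?add0r// => i /andP[_ im].
by rewrite ltn_eqF// scale0r.
Qed.

Lemma finite_combsZ (V : lmodType R) (F : nat -> V) a x :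
  finite_combs F x -> finite_combs F (a *: x).
Proof.
move=> [k [b ->]]; exists k, (fun i => a * b i).
by rewrite /comb scaler_sumr; apply: eq_bigr => i _; rewrite scalerA.
Qed.

Lemma finite_combsD (V : lmodType R) (F : nat -> V) x y :
  finite_combs F x -> finite_combs F y -> finite_combs F (x + y).
Proof.
have ext k k' a : (k <= k')%N ->
    comb F k a = comb F k' (fun i => if (i < k)%N then a i else 0).
  move=> kk'; rewrite /comb [RHS](big_cat_nat (leq0n k) kk')/=.
  rewrite [X in _ = _ + X]big_nat_cond [X in _ = _ + X]big1 ?addr0.
    by rewrite !big_nat; apply: eq_bigr => i /andP[_ ->].
  by move=> i /andP[/andP[ki _] _]; rewrite ltnNge ki scale0r.
move=> [k [a ->]] [m [b ->]].
rewrite (ext _ _ a (leq_maxl k m)) (ext _ _ b (leq_maxr k m)).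
exists (maxn k m), (fun i => (if (i < k)%N then a i else 0) + (if (i < m)%N then b i else 0)).
by rewrite /comb -big_split/=; apply: eq_bigr => i _; rewrite scalerDl.
Qed.

Lemma max_nat (b : nat -> R) k : exists n, forall m, (m <= k)%N -> `|b m| <= `|b n|.
Proof.
elim: k => [|k [n IH]]; first by exists 0%N => m; rewrite leqn0 => /eqP ->.
have [h|/ltW h] := leP `|b k.+1| `|b n|.
  by exists n => m; rewrite leq_eqVlt => /orP[/eqP ->|/IH].
exists k.+1 => m; rewrite leq_eqVlt => /orP[/eqP ->//|/IH mn].
exact: le_trans h.
Qed.

(** Let [b p] be the largest tail sum in absolute value. Coefficients are differences of tail sums,
    so at most [2 * |b p|], and the errors [2 ^- i.+3] of [g] sum to at most 1/4. Hence [b p]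
    differs from [g p u] by at most [|b p| / 2], which is absorbed. *)
Lemma tail_sum_bound k a n :
  `|\sum_(0 <= i < k) a i * (n <= i)%:R : R| <= 2 * M * `|comb z k a|.
Proof.
pose b n : R := \sum_(0 <= i < k) a i * (n <= i)%:R.
set u := comb z k a.
have bge m : (k <= m)%N -> b m = 0.
  move=> km; rewrite /b big_nat big1// => i /andP[_ ik].
  by rewrite leqNgt (leq_trans ik km) mulr0.
have [p pmax] := max_nat b k.
have bmax m : `|b m| <= `|b p|.
  by have [km|/pmax//] := ltnP k m; rewrite bge ?normr0// ltnW.
have ab i : (i < k)%N -> a i = b i - b i.+1.
  move=> ik; rewrite /b -sumrB (bigD1_seq i)/= ?mem_index_iota ?iota_uniq//.
  rewrite leqnn ltnn mulr1 mulr0 subr0 big1 ?addr0// => j ji.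
  by rewrite leq_eqVlt eq_sym (negbTE ji) /= subrr.
have amax i : (i < k)%N -> `|a i| <= 2 * `|b p|.
  move=> /ab ->; apply: (le_trans (ler_normB _ _)).
  by have := bmax i; have := bmax i.+1; lra.
have gu m : `|b m - g m u : R| <= `|b p| / 2.
  rewrite /u /comb linear_sum /b -sumrB.
  apply: (le_trans (ler_norm_sum _ _ _)).
  apply: (@le_trans _ _ (\sum_(0 <= i < k) (2 * `|b p|) * (2 ^- 2 * 2 ^- i.+1))).
    rewrite !big_nat; apply: ler_sum => i /andP[_ ik].
    rewrite linearZ.
    have -> : a i * (m <= i)%:R - a i * g m (z i) = a i * ((m <= i)%:R - g m (z i)) :> R.
      by rewrite mulrBr.
    rewrite normrM ler_pM ?amax//.
    rewrite -invfM -exprD; have [mi|im] := leqP m i; first exact/ltW/g1.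
    by rewrite g0// subrr normr0 invr_ge0 exprn_ge0.
  rewrite -!mulr_sumr sum_half_powers mulrCA.
  have h : (0 : R) <= 2 ^- k by rewrite invr_ge0 exprn_ge0.
  have h2 : (2 : R) ^- 2 * (1 - 2 ^- k) <= 4^-1.
    by rewrite -natrX ger_pMr ?invr_gt0//; lra.
  have := ler_wpM2l (mulr_ge0 (ler0n R 2) (normr_ge0 (b p))) h2; lra.
have h1 := gM p u.
have h2 := ler_normD (b p - g p u : R) (g p u).
have h3 := gu p.
have : `|b p| <= M * `|u| + `|b p| / 2.
  by move: h2; rewrite subrK; lra.
have := bmax n; rewrite /b; lra.
Qed.

(** By [tail_sum_bound], the combinations whose tail sum from [n] is 1 have norm at least
    [(2 * M)^-1]. A functional bounded below on this affine set is constant on it; dividing by its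
    value at [z n] gives exact values. *)
Lemma biorthogonal_functional n : exists e : {linear X -> R^o},
  (forall x, `|e x : R| <= 2 * M * `|x|) /\ forall m, e (z m) = (n <= m)%:R :> R.
Proof.
have M20 : 0 < 2 * M by rewrite mulr_gt0.
(* Pairing each vector with its tail indicator records the tail sum alongside the combination,
   without choosing coefficients for a vector. *)
pose F m : X * R^o := (z m, (n <= m)%:R).
pose D := [set x | finite_combs F (x, 1)].
have Dz m (c : R) : D (z n + c *: (z m - (n <= m)%:R *: z n)).
  have := finite_combsD (finite_combs_mem F n) (finite_combsZ c (finite_combsD
    (finite_combs_mem F m) (finite_combsZ (- (n <= m)%:R) (finite_combs_mem F n)))).
  rewrite /F leqnn; congr (finite_combs _ _); congr (_, _).
    by rewrite /= scaleNr.
  rewrite /= [(- _)%R *: _]mulr1 subrr [c *: _]mulr0 addr0.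
  by [].
have Dzn : D (z n) by have := Dz n 0; rewrite scale0r addr0.
have [|||f [f1 fD]] := @mazur_separation R X D (2 * M)^-1.
- by exists (z n).
- move=> x y t Dx Dy t0 t1.
  have := finite_combsD (finite_combsZ t Dx) (finite_combsZ (1 - t) Dy).
  rewrite /D /=; congr (finite_combs _ _); congr (_, _).
  by rewrite /= [t *: _]mulr1 [(1 - t) *: _]mulr1 addrC subrK.
- move=> x [k [a xE]].
  have [x1 x2] : x = comb z k a /\ 1 = \sum_(0 <= i < k) a i * (n <= i)%:R.
    by move: xE; rewrite comb_pair => -[? ?]; split.
  have := tail_sum_bound k a n; rewrite -x2 -x1 normr1 => h.
  by rewrite -[leLHS]mulr1 ler_pdivrMl.
have fn : (2 * M)^-1 <= f (z n) by exact: fD.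
have fn0 : 0 < f (z n) by apply: lt_le_trans fn; rewrite invr_gt0.
exists ((f (z n) : R)^-1 \*: f); split => [x|m] /=.
  rewrite normrM ger0_norm ?invr_ge0 ?(ltW fn0)// ler_pM ?invr_ge0 ?(ltW fn0)//.
  by rewrite -[leRHS]invrK lef_pV2 ?posrE ?invr_gt0.
have w0 : f (z m - (n <= m)%:R *: z n) = 0 :> R.
  set w := z m - _; apply/eqP; apply: contrapT => /negP fw0.
  (* This coefficient gives a point of [D] where [f] is 0. *)
  have := fD _ (Dz m (- (f (z n)) / f w : R)).
  rewrite -/w linearD.
  have -> : f ((- f (z n) / f w : R) *: w) = - f (z n).
    by rewrite linearZ; exact: divfK.
  by rewrite subrr leNgt invr_gt0 M20.
move: w0; rewrite linearB linearZ => /eqP; rewrite subr_eq0 => /eqP ->.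
by rewrite [LHS]mulrCA mulVf ?mulr1// gt_eqF.
Qed.

Hypothesis zf : forall a : seq rat, exists (f : {linear X -> R^o}) (l : R),
  [/\ forall x, `|f x : R| <= `|x|,
      f (rat_comb z a) = `|rat_comb z a| :> R &
      (fun n => f (z n) : R^o) @ \oo --> (l : R^o)].

Lemma rat_comb_dense k a (r : R) : 0 < r ->
  exists s, `|comb z k a - rat_comb z s| < r.
Proof.
move=> r0; pose c := r / ((k%:R + 1) * (B + 1)).
have k1 : 0 < k%:R + 1 :> R by rewrite ltr_wpDl.
have B1 : 0 < B + 1 by rewrite ltr_wpDl.
have c0 : 0 < c by rewrite divr_gt0// mulr_gt0.
have qex i : exists q : rat, `|a i - ratr q| < c.
  have /rat_in_itvoo[q] : a i - c < a i + c by lra.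
  rewrite in_itv /= => /andP[h1 h2]; exists q.
  by rewrite ltr_norml; apply/andP; split; lra.
have [q qP] := choice qex.
exists (mkseq q k); rewrite /rat_comb /comb size_mkseq -sumrB.
apply: (le_lt_trans (ler_norm_sum _ _ _)).
apply: (@le_lt_trans _ _ (\sum_(0 <= i < k) c * (B + 1))).
  rewrite !big_nat; apply: ler_sum => i /andP[_ ik].
  rewrite nth_mkseq// -scalerBl normrZ ler_pM// ?(ltW (qP i))//.
  by apply: le_trans (zB i) _; rewrite lerDl.
rewrite sumr_const_nat subn0 -mulr_natl.
have -> : r = (k%:R + 1) * (c * (B + 1)).
  by rewrite /c; field; rewrite !gt_eqF.
by rewrite ltr_pM2r ?ltrDl// mulr_gt0.
Qed.

(** Off the closed span of [z], a functional vanishing on every [z n] works. Within it, approximate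
    [y] by a rational combination [ys] and correct a norming functional of [ys] to be null along
    [z]. *)
Lemma null_functionals_separate y : y != 0 ->
  exists2 f, null_functionals z f & f y != 0.
Proof.
move=> y0.
have [[r r0 yr]|nyr] :=
    pselect (exists2 r, 0 < r & forall w, finite_combs z w -> r <= `|y - w|).
  have z0 : finite_combs z 0.
    by have := finite_combsZ 0 (finite_combs_mem z 0); rewrite scale0r.
  have [|||f [f1 fD]] := @mazur_separation R X [set y - w | w in finite_combs z] r.
  - by exists (y - 0), 0.
  - move=> _ _ t [w zw <-] [v zv <-] t0 t1; exists (t *: w + (1 - t) *: v).
      by apply: finite_combsD; exact: finite_combsZ.
    rewrite !scalerBr [RHS]addrACA -opprD; congr (_ - _).
    by rewrite -scalerDl addrC subrK scale1r.
  - by move=> _ [w zw <-]; exact: yr.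
  have fy : r <= f y by have := fD (y - 0); rewrite subr0; apply; exists 0; rewrite ?subr0.
  exists f; last by rewrite gt_eqF// (lt_le_trans r0).
  split; first by apply: (@linear_bounded_cont _ _ f 1) => x; rewrite mul1r.
  have -> : (f \o z : nat -> R^o) = fun=> 0; last exact: cvg_cst.
  apply/funext => m /=; apply/eqP; apply: contrapT => /negP fz.
  have := fD (y - (f y / f (z m) : R) *: z m).
  move=> /(_ (ex_intro2 _ _ _ (finite_combsZ _ (finite_combs_mem z m)) erefl)).
  rewrite linearB.
  have -> : f ((f y / f (z m) : R) *: z m) = f y.
    by rewrite linearZ; exact: divfK.
  by rewrite subrr leNgt r0.
pose L := 1 + B * M.
have L0 : 0 < L by rewrite ltr_wpDr ?mulr_ge0// ltW.
have yp : 0 < `|y| by rewrite normr_gt0.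
(* [L] bounds the norm of [G] below. If [G y = 0], then [|ys| <= L * |y - ys|], so
   [|y| <= (1 + L) * (2 * r) = |y| / 2]. *)
pose r := `|y| / (4 * (1 + L)).
have L1 : 0 < 1 + L by rewrite addr_gt0.
have r0 : 0 < r by rewrite divr_gt0// mulr_gt0.
have [w [k [a ->]] yw] : exists2 w, finite_combs z w & `|y - w| < r.
  apply: contrapT => nw; apply: nyr; exists r => // w zw.
  by rewrite leNgt; apply/negP => ?; apply: nw; exists w.
have [s ws] := rat_comb_dense k a r0.
set ys := rat_comb z s in ws.
have yys : `|y - ys| < 2 * r.
  have -> : y - ys = (y - comb z k a) + (comb z k a - ys) by rewrite addrA subrK.
  by have := ler_normD (y - comb z k a) (comb z k a - ys); move: yw ws; lra.
have [f [l [f1 fys fl]]] := zf s; rewrite -/ys in fys.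
have lB : `|l| <= B.
  have h : (fun n => `|f (z n) : R|) @ \oo --> `|l| by exact: (@cvg_norm _ R^o).
  apply: (@closed_cvg _ R^o _ _ _ [set x | x <= B] _ _ _ h).
    exact: closed_le.
  by apply: nearW => n /=; apply: le_trans (f1 _) (zB n).
(* [g (size s)] tends to 1 along [z], which cancels the limit [l], and it vanishes on the terms
   occurring in [ys], so [G ys = |ys|]. *)
pose G : {linear X -> R^o} := f \- (l \*: g (size s)).
have GE x : G x = f x - l * g (size s) x :> R by [].
have GL x : `|G x : R| <= L * `|x|.
  rewrite GE; apply: (le_trans (ler_normB _ _)); rewrite normrM.
  have h : `|l| * `|g (size s) x : R| <= B * (M * `|x|) by rewrite ler_pM.
  by have := f1 x; rewrite /L; lra.
exists G.
  split; first exact: linear_bounded_cont GL.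
  have gl : (fun n => g (size s) (z n) : R^o) @ \oo --> (1 : R^o).
    apply/cvgrPdist_lt => e e0.
    near=> n; apply: (@lt_trans _ _ (2 ^- n.+3)); last first.
      by near: n; exact: (near_half_power_lt 3).
    by apply: g1; near: n; exact: nbhs_infty_ge.
  have h := cvg_comb (a := 1) (b := - l) fl gl.
  have E : 1 *: (l : R^o) + - l *: (1 : R^o) = 0.
    by rewrite scale1r [_ *: _]mulr1 subrr.
  rewrite E in h.
  apply: (eventually_eq_cvg (N := 0%N) _ h) => n _.
  by rewrite scale1r scaleNr; exact: esym (GE (z n)).
have gys : g (size s) ys = 0 :> R.
  rewrite /ys /rat_comb linear_sum big_nat big1// => i /andP[_ iss].
  by rewrite linearZ g0//; exact: mulr0.
apply/negP => /eqP Gy.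
have := GL (ys - y); rewrite linearB Gy subr0 GE gys mulr0 subr0 fys normr_id.
rewrite distrC => h.
have h1 : L * `|y - ys| <= L * (2 * r) by rewrite ler_wpM2l// ltW.
have h2 := ler_normD (y - ys) ys; rewrite subrK in h2.
have h3 : (1 + L) * (2 * r) = `|y| / 2 by rewrite /r; field; rewrite gt_eqF.
lra.
Unshelve. all: by end_near.
Qed.

End Biorthogonal.

(** * The equivalence *)

Lemma not_weakly_compact_not_wG_FPP {R : realType}
    {X : completeNormedModType R} (C : set X) : calB setT C ->
  ~ weakly_compact C -> ~ has_wG_FPP affine_bi_lipschitz C.
Proof.
move=> [[x0 Cx0] Cb Ccl Cc _].
rewrite /weakly_compact compact_ultra => /existsNP[U] /not_implyP[UU].
move=> /not_implyP[UC nU].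
have Unc p : C p -> ~ (U --> (p : @weak_space R X)).
  by move=> Cp Up; apply: nU; exists p.
have [d d0 Ud] := ultrafilter_apart_point UU UC Cc Ccl Unc.
have [z [g [Cz gM g0 g1 zf]]] := triangular_sequence UU UC Cc Cb d0 Ud Cx0.
have [B B0 zB] := z_bounded Cx0 Cz Cb.
have d20 : 0 < 2 / d by rewrite divr_gt0.
have [e eP] := choice (biorthogonal_functional d20 gM g0 g1).
apply: (@simplex_not_wG_FPP _ _ C x0 z e (2 * (2 / d))) => //.
- by move=> n x; exact: (eP n).1.
- by move=> n m; exact: (eP n).2.
- by move=> y; apply: (null_functionals_separate d20 (ltW B0) zB gM g0 g1 zf).
- by rewrite mulr_gt0.
Qed.

Theorem mainTheorem1 (R : realType) (X : completeNormedModType R)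
    (C : set X) (hC : calB setT C) :
  weakly_compact C <-> has_wG_FPP affine_bi_lipschitz C.
Proof.
split=> [Cw tau _ K [[K0 Kb Kcl Kc KC] _] T KT [Taff [c [L [_ _ TL]]]]|Cfpp].
  apply: (weakly_compact_fixed_point K0 Kb Kc KT Taff Cw KC Kcl (L := L)).
  by move=> x y Kx Ky; exact: (TL x y Kx Ky).2.
by apply: contrapT => /(not_weakly_compact_not_wG_FPP hC).
Qed.
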